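(* Let $0<\beta<1$, $\alpha>2\beta$ and $f\in\Lambda^\alpha_{\mathcal{L}}$. Suppose that (1) $f(t_0,x_0)=0$ for some $(t_0,x_0)\in\mathbb{R}^{n+1}$, and (2) $f(t,x)\ge0$ for all $t\le t_0$, $x\in\mathbb{R}^n$. Then $\mathcal{L}^\beta f(t_0,x_0)\le0$. Moreover, $\mathcal{L}^\beta f(t_0,x_0)=0$ if and only if $f(t,x)=0$ for all $t\le t_0$ and $x\in\mathbb{R}^n$.
   Context: Fix $n\ge1$ and let $\mathcal{L}=\partial_t-\Delta_x+|x|^2$ on $\mathbb{R}^{n+1}\ni(t,x)$. For $f\in L^\infty(\mathbb{R}^{n+1})$ and $y>0$ the Poisson semigroup $\mathcal{P}_y=e^{-y\sqrt{\mathcal{L}}}$ is $$\mathcal{P}_yf(t,x)=\frac{y}{2\sqrt\pi}\int_0^\infty\int_{\mathbb{R}^n}e^{-\frac{y^2}{4\tau}}\,\frac{e^{-\frac{|x-z|^2}{4}\coth\tau}\,e^{-\frac{|x+z|^2}{4}\tanh\tau}}{(2\pi\sinh2\tau)^{n/2}}\,f(t-\tau,z)\,dz\,\frac{d\tau}{\tau^{3/2}}.$$ For $\alpha>0$, with $k=[\alpha]+1$ ($[\cdot]$ the integer part), $\Lambda^\alpha_{\mathcal{L}}$ is the set of $f\in L^\infty(\mathbb{R}^{n+1})$ for which there is a constant $C_k$ with $\|\partial_y^k\mathcal{P}_yf\|_{L^\infty(\mathbb{R}^{n+1})}\le C_ky^{-k+\alpha}$ for all $y>0$. Functions in $\Lambda^\alpha_{\mathcal{L}}$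 agree almost everywhere with a continuous function, and are taken to be continuous, so that pointwise values make sense. For $\beta>0$, $$\mathcal{L}^\beta f(t,x)=\frac1{c_{2\beta}}\int_0^\infty(\mathcal{P}_\tau-I)^{[2\beta]+1}f(t,x)\,\frac{d\tau}{\tau^{1+2\beta}},\qquad c_{2\beta}=\int_0^\infty(e^{-\tau}-1)^{[2\beta]+1}\frac{d\tau}{\tau^{1+2\beta}}.$$ *)

(* Defs.v *)
From HB Require Import structures.
From mathcomp Require Import all_boot all_order all_algebra.
From mathcomp Require Import all_classical all_reals all_analysis.

Set Implicit Arguments.
Unset Strict Implicit.
Unset Printing Implicit Defensive.

Import Order.TTheory GRing.Theory Num.Theory.
Import numFieldNormedType.Exports.

Local Open Scope classical_set_scope.
Local Open Scope ring_scope.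

(** The library has Lebesgue measure only in dimension one. Row vectors get the
    sigma-algebra generated by the coordinates (the Borel one when [T] is the
    real line), as the library does for tuples. *)
Definition measure_rV_display : measure_display -> measure_display.
Proof. exact. Qed.

Section measurable_rV.
Context {d} {T : measurableType d}.
Variable n : nat.

Let coord : 'I_n -> 'rV[T]_n -> T := fun i x => x ord0 i.

Let rV_set0 : g_sigma_preimage coord set0.
Proof. exact: sigma_algebra0. Qed.

Let rV_setC A : g_sigma_preimage coord A -> g_sigma_preimage coord (~` A).
Proof. exact: sigma_algebraC. Qed.

Let rV_bigcup (F : (set 'rV[T]_n)^nat) :
  (forall i, g_sigma_preimage coord (F i)) ->
  g_sigma_preimage coord (\bigcup_i (F i)).
Proof. exact: sigma_algebra_bigcup. Qed.

HB.instance Definition _ := @isMeasurable.Build (measure_rV_display d)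
  'rV[T]_n (g_sigma_preimage coord) rV_set0 rV_setC rV_bigcup.

End measurable_rV.

Lemma measurable_rV_coord d (T : measurableType d) (n : nat) (i : 'I_n) :
  measurable_fun [set: 'rV[T]_n] (fun x : 'rV[T]_n => x ord0 i).
Proof.
move=> _ Y mY; rewrite setTI; apply: sub_sigma_algebra => /=.
rewrite -bigcup_seq/=; exists i => /=; first by rewrite mem_index_enum.
by exists Y => //; rewrite setTI.
Qed.

Lemma measurable_rVP d d' (S : measurableType d') (T : measurableType d) (n : nat)
    (f : S -> 'rV[T]_n) :
  (forall i, measurable_fun [set: S] (fun s => f s ord0 i)) ->
  measurable_fun [set: S] f.
Proof.
case: n f => [|n] f mf; apply: (@measurability _ _ _ _ _ _
  (\big[setU/set0]_(i < _)
    preimage_set_system setT (fun x : 'rV[T]_ _ => x ord0 i) measurable)) => //;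
  move=> _ [B + <-]; first by rewrite big_ord0.
rewrite -bigcup_mkord_ord => -[i Ii [A mA <-]]; rewrite !setTI.
by rewrite -[X in measurable X]setTI; exact: mf.
Qed.

Definition rV_cons (T : Type) (n : nat) (p : T * 'rV[T]_n) : 'rV[T]_n.+1 :=
  \row_(i < n.+1) if unlift ord0 i is Some j then p.2 ord0 j else p.1.

Definition rV_uncons (T : Type) (n : nat) (x : 'rV[T]_n.+1) : T * 'rV[T]_n :=
  (x ord0 ord0, \row_(j < n) x ord0 (lift ord0 j)).

Lemma rV_consK (T : Type) (n : nat) : cancel (@rV_cons T n) (@rV_uncons T n).
Proof.
move=> [t x]; rewrite /rV_uncons !mxE unlift_none/=; congr (_, _).
by apply/rowP => j; rewrite !mxE liftK.
Qed.

Lemma rV_unconsK (T : Type) (n : nat) : cancel (@rV_uncons T n) (@rV_cons T n).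
Proof.
move=> x; apply/rowP => i; rewrite mxE.
by case: unliftP => [j ->|->]; rewrite //= mxE.
Qed.

Lemma measurable_rV_cons d (T : measurableType d) (n : nat) :
  measurable_fun [set: T * 'rV[T]_n] (@rV_cons T n).
Proof.
apply: measurable_rVP => i; under eq_fun do rewrite mxE.
case: unliftP => [j _|_]; last exact: measurable_fst.
apply: (@measurableT_comp _ _ _ _ _ _ (fun x : 'rV[T]_n => x ord0 j)) => //.
exact: measurable_rV_coord.
Qed.

Lemma measurable_rV_uncons d (T : measurableType d) (n : nat) :
  measurable_fun [set: 'rV[T]_n.+1] (@rV_uncons T n).
Proof.
apply: measurable_fun_pair; first exact: measurable_rV_coord.
by apply: measurable_rVP => i; under eq_fun do rewrite mxE;
  exact: measurable_rV_coord.
Qed.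

(** [n]-dimensional Lebesgue measure, by transporting the product measure along
    the identification of [R * R^n] with [R^(n+1)]. *)
Fixpoint lebesgue_rV (R : realType) (n : nat) : set 'rV[R]_n -> \bar R :=
  match n with
  | 0 => \d_(0 : 'rV[R]_0)
  | m.+1 => pushforward (lebesgue_measure \x @lebesgue_rV R m)%E (@rV_cons R m)
  end.
Arguments lebesgue_rV {R n}.

Section lebesgue_rV_measure.
Context {R : realType}.

Section pushforward_rV_cons.
Context (n : nat) (mu : {sigma_finite_measure set 'rV[R]_n -> \bar R}).

Let m : set 'rV[R]_n.+1 -> \bar R :=
  pushforward (lebesgue_measure \x mu)%E (@rV_cons R n).

Let mcons := @measurable_rV_cons _ R n.

Let m0 : m set0 = 0%E. Proof. exact: measure0. Qed.

Let m_ge0 A : (0 <= m A)%E. Proof. exact: measure_ge0. Qed.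

Let m_sigma_additive : semi_sigma_additive m.
Proof. exact: measure_semi_sigma_additive. Qed.

HB.instance Definition _ := isMeasure.Build _ _ _ m m0 m_ge0 m_sigma_additive.

Let m_sigma_finite : sigma_finite [set: 'rV[R]_n.+1] m.
Proof.
have /sigma_finiteP[F [FT ndF Foo]] := sigma_finiteT (@lebesgue_measure R).
have /sigma_finiteP[G [GT ndG Goo]] := sigma_finiteT mu.
exists (fun k => @rV_uncons R n @^-1` (F k `*` G k)).
  rewrite -preimage_bigcup (_ : \bigcup_k _ = setT) ?preimage_setT//.
  rewrite -setXTT FT GT predeqE => -[x y]; split.
    by move=> [k _ []/= ? ?]; split; exists k.
  move=> [/= [i _ Fx] [j _ Gy]]; exists (maxn i j) => //; split.
    by move: x Fx; exact/subsetPset/ndF/leq_maxl.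
  by move: y Gy; exact/subsetPset/ndG/leq_maxr.
move=> k; have [mF Fk] := Foo k; have [mG Gk] := Goo k; split.
  rewrite -[X in measurable X]setTI.
  by apply: measurable_rV_uncons => //; exact: measurableX.
rewrite /m /pushforward -comp_preimage (_ : _ \o _ = id); last first.
  by apply/funext => p /=; rewrite rV_consK.
rewrite preimage_id product_measure1E// lte_mul_pinfty// ge0_fin_numE//.
Qed.

HB.instance Definition _ := Measure_isSigmaFinite.Build _ _ _ m m_sigma_finite.

Lemma pushforward_rV_cons_ex :
  exists nu : {sigma_finite_measure set 'rV[R]_n.+1 -> \bar R},
    nu = pushforward (lebesgue_measure \x mu)%E (@rV_cons R n)
      :> (set 'rV[R]_n.+1 -> \bar R).
Proof. by exists m. Qed.

End pushforward_rV_cons.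

Lemma lebesgue_rV_ex (n : nat) :
  exists mu : {sigma_finite_measure set 'rV[R]_n -> \bar R},
    mu = lebesgue_rV :> (set 'rV[R]_n -> \bar R).
Proof.
elim: n => [|n [mu IHn]]; first by exists \d_(0 : 'rV[R]_0).
by rewrite /= -IHn; exact: pushforward_rV_cons_ex.
Qed.

Variable n : nat.
Let mu : set 'rV[R]_n -> \bar R := lebesgue_rV.

Let lebesgue_rV0 : mu set0 = 0%E.
Proof. by rewrite /mu; have [nu <-] := lebesgue_rV_ex n. Qed.

Let lebesgue_rV_ge0 A : (0 <= mu A)%E.
Proof. by rewrite /mu; have [nu <-] := lebesgue_rV_ex n. Qed.

Let lebesgue_rV_sigma_additive : semi_sigma_additive mu.
Proof.
by rewrite /mu; have [nu <-] := lebesgue_rV_ex n;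
  exact: measure_semi_sigma_additive.
Qed.

Let lebesgue_rV_sigma_finite : sigma_finite setT mu.
Proof.
by rewrite /mu; have [nu <-] := lebesgue_rV_ex n; exact: sigma_finiteT.
Qed.

HB.instance Definition _ := isMeasure.Build _ _ _ (@lebesgue_rV R n)
  lebesgue_rV0 lebesgue_rV_ge0 lebesgue_rV_sigma_additive.
HB.instance Definition _ := Measure_isSigmaFinite.Build _ _ _ (@lebesgue_rV R n)
  lebesgue_rV_sigma_finite.

End lebesgue_rV_measure.

Definition spacetime_measure (R : realType) (n : nat) :
    {measure set (measurableTypeR R * 'rV[R]_n) -> \bar R} :=
  (lebesgue_measure \x lebesgue_rV)%E.

Section Lipschitz_space.
Context {R : realType}.
Implicit Types (a s y tau : R) (n m : nat).

Definition sinh a : R := (expR a - expR (- a)) / 2.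
Definition cosh a : R := (expR a + expR (- a)) / 2.
Definition tanh a : R := sinh a / cosh a.
Definition coth a : R := cosh a / sinh a.

(* The Euclidean norm; the library's norm on ['rV[R]_n] is the sup norm. *)
Definition euclid n (x : 'rV[R]_n) : R := Num.sqrt (\sum_i x ord0 i ^+ 2).

Definition mehler_kernel n tau (x z : 'rV[R]_n) : R :=
  expR (- (euclid (x - z) ^+ 2 / 4 * coth tau)) *
  expR (- (euclid (x + z) ^+ 2 / 4 * tanh tau)) /
  (2 * pi * sinh (2 * tau)) `^ (n%:R / 2).

Definition poisson n y (f : R * 'rV[R]_n -> R) : R * 'rV[R]_n -> R := fun p =>
  y / (2 * Num.sqrt pi) *
  \int[lebesgue_measure]_(tau in `]0, +oo[)
    ((\int[lebesgue_rV]_z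
        (expR (- (y ^+ 2 / (4 * tau))) * mehler_kernel tau p.2 z *
         f (p.1 - tau, z))) / tau `^ (3 / 2)).

Definition poisson_diff n m y (f : R * 'rV[R]_n -> R) : R * 'rV[R]_n -> R :=
  iter m (fun g p => poisson y g p - g p) f.

(* For [f] bounded, [y |-> poisson y f p] is smooth on the half-line [y > 0], so
   the total iterated derivative below is the genuine one there. *)
Definition Lambda n a : set (R * 'rV[R]_n -> R) :=
  [set f | f \in Lfun (@spacetime_measure R n) +oo%E /\
    let k := (Num.truncn a).+1 in
    exists C : R, forall y, 0 < y ->
      ('N[@spacetime_measure R n]_+oo
         [(fun p => (derive1n k (fun s => poisson s f p) y)%:E)]
       <= (C * y `^ (- k%:R + a))%:E)%E].

Definition frac_const a : R :=
  \int[lebesgue_measure]_(tau in `]0, +oo[)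
    ((expR (- tau) - 1) ^+ (Num.truncn a).+1 / tau `^ (1 + a)).

Definition frac_power n a (f : R * 'rV[R]_n -> R) : R * 'rV[R]_n -> R := fun p =>
  (frac_const (2 * a))^-1 *
  \int[lebesgue_measure]_(tau in `]0, +oo[)
    (poisson_diff (Num.truncn (2 * a)).+1 tau f p / tau `^ (1 + 2 * a)).

End Lipschitz_space.

(* Main.v *)
Require Import Defs.
From HB Require Import structures.
From mathcomp Require Import all_boot all_order all_algebra.
From mathcomp Require Import all_classical all_reals all_analysis.
From mathcomp Require Import measurable_realfun ess_sup_inf ring lra.
Set Implicit Arguments.
Unset Strict Implicit.
Unset Printing Implicit Defensive.
Import Order.TTheory GRing.Theory Num.Theory.
Import numFieldNormedType.Exports.
Local Open Scope classical_set_scope.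
Local Open Scope ring_scope.

(** The Poisson semigroup [P_y] averages the heat semigroup [heat] of the operator
    over time against the one-sided 1/2-stable density [stable y]
    ([poissonE]). Both the kernel and the density are positive, and only the past
    of a point enters. Hence [P_y f >= 0] at the point [p0 = (t0, x0)], where
    [f] vanishes, and [f] may be replaced by its positive part.

    Let [m = [2 beta] + 1], which is [1] or [2]. If [m = 1], then
    [(P_y - I) f (p0) = P_y f (p0)]. If [m = 2], the semigroup law
    ([poisson_semigroup]) gives
    [(P_y - I)^2 f (p0) = - (2 P_y f - P_(2y) f) (p0)], and the right-hand side
    is nonpositive because [2 * stable y > stable (2 * y)] pointwise
    ([defect_weight_gt0]). In both cases the integrand of the fractional power has
    the sign opposite to that of the normalizing constant
    ([poisson_diff_defect]), which proves the inequality. The semigroup law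
    itself rests on the Chapman-Kolmogorov identity for the Mehler kernel, a
    Gaussian integral ([mehler_kernel_semigroup]), and on the convolution
    identity for the stable densities ([stable_convolution]).

    If the fractional power is [0], the integrand, which has constant sign,
    vanishes at some [y], provided that the integral converges. Then the heat
    averages of [f] at [p0] vanish for almost every time, and so does [f] in the
    past ([defect_poisson_eq0]).

    Convergence at [y = 0] is where the Lipschitz condition is used
    ([defect_bound]). It bounds a derivative of order [k >= m] in [y]; for almost
    every point of the past this bound holds at all [y], since the derivatives
    are explicit moments, continuous in [y] ([Lambda_derivative_bound]). With an
    exponent [a] in [(2 beta, min(alpha, m))], integrating down to order [m] and
    then over increments of the integrand shows that it is at most
    [C f(p) + C y^a], with constants independent of the point [p]
    ([defect_hoelder], [poisson_le_near]). As [p] tends to [p0] through such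
    points, [f(p)] tends to [0], and Fatou's lemma ([fatou_heat]) gives the bound
    [C y^a] at [p0], which is integrable against [y^(-1-2beta)]
    ([integrable_div_powR]). *)

(** * Integration on the half-line *)

Section primitives.
Context {R : realType}.
Notation leb := (@lebesgue_measure R).

(** Monotone convergence reduces the integral to compact subintervals, so the
    integrand and its primitive may be singular at the ends of the domain. *)
Lemma ge0_integral_bigcup_primitive (f F : R -> R) (D : set R)
    (x_ y_ : nat -> R) (l : R) :
  (forall n, x_ n < y_ n) ->
  {homo x_ : n m / (n <= m)%N >-> m <= n} ->
  {homo y_ : n m / (n <= m)%N >-> n <= m} ->
  D = \bigcup_n `[x_ n, y_ n]%classic ->
  (forall t, D t -> 0 <= f t) ->
  (forall t, D t -> {for t, continuous f}) ->
  (forall t, D t -> is_derive t 1 F (f t)) ->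
  F (y_ n) - F (x_ n) @[n --> \oo] --> l ->
  (\int[leb]_(t in D) (f t)%:E = l%:E)%E.
Proof.
move=> xy x_ni y_nd DE f0 cf dF Fl.
have subD n : `[x_ n, y_ n]%classic `<=` D by move=> t tn; rewrite DE; exists n.
have cw n : {within `[x_ n, y_ n], continuous f}.
  apply: continuous_in_subspaceT => t /set_mem tn.
  by apply: cf; exact: (subD n).
have cvgI : (\int[leb]_(t in `[x_ n, y_ n]) (f t)%:E @[n --> \oo] -->
    \int[leb]_(t in \bigcup_n `[x_ n, y_ n]%classic) (f t)%:E)%E.
  apply: ge0_nondecreasing_set_cvg_integral => //.
  - move=> n m nm; apply/subsetPset; apply: subset_itv; rewrite bnd_simp.
      exact: x_ni.
    exact: y_nd.
  - move=> n; apply/measurable_EFinP.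
    by apply: subspace_continuous_measurable_fun => //; exact: cw.
  - by move=> n t /subD /f0; rewrite lee_fin.
rewrite DE -(cvg_lim _ cvgI)//.
have -> : (fun n => \int[leb]_(t in `[x_ n, y_ n]) (f t)%:E)%E =
    (fun n => (F (y_ n) - F (x_ n))%:E).
  apply/funext => n; rewrite EFinB; apply: continuous_FTC2 => //.
  - have dFn t : D t -> derivable F t 1 by move=> /dF[].
    have cFn t : D t -> {for t, continuous F}.
      by move=> Dt; apply/differentiable_continuous/derivable1_diffP/dFn.
    split.
    + by move=> t tn; apply: dFn; apply: (subD n); apply: subset_itv_oo_cc tn.
    + apply: cvg_at_right_filter; apply: cFn; apply: (subD n).
      by rewrite /= in_itv/= lexx ltW.
    + apply: cvg_at_left_filter; apply: cFn; apply: (subD n).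
      by rewrite /= in_itv/= lexx ltW.
  - move=> t tn; have /dF dFt : D t.
      by apply: (subD n); apply: subset_itv_oo_cc tn.
    by rewrite derive1E; exact: derive_val.
by apply: cvg_lim => //; apply: cvg_EFin => //; exact: nearW.
Qed.

Lemma ge0_integral0y_primitive (f F : R -> R) (a l : R) :
  (forall t : R, 0 < t -> 0 <= f t) ->
  (forall t : R, 0 < t -> {for t, continuous f}) ->
  (forall t : R, 0 < t -> is_derive t 1 F (f t)) ->
  F t @[t --> (0:R)^'+] --> a -> F t @[t --> +oo%R] --> l ->
  (\int[leb]_(t in `]0%R, +oo[) (f t)%:E = (l - a)%:E)%E.
Proof.
move=> f0 cf dF Fa Fl.
have D0 t : `]0, +oo[%classic t -> 0 < t by rewrite /= in_itv/= andbT.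
apply: (@ge0_integral_bigcup_primitive f F _ (fun n => n.+1%:R^-1)
  (fun n => n.+2%:R)).
- move=> n; rewrite (@le_lt_trans _ _ 1)//; last by rewrite ltr1n.
  by rewrite invf_le1// ler1n.
- by move=> n m nm; rewrite lef_pV2 ?posrE// ler_nat.
- by move=> n m nm; rewrite ler_nat.
- apply/seteqP; split=> t /=.
    rewrite in_itv/= andbT => t0.
    have [n tn] := ltr_add_invr t0.
    have [m tm] := ltr_add_invr t0.
    exists (maxn n (Num.truncn t)) => //=; rewrite in_itv/=; apply/andP; split.
      rewrite add0r in tn; rewrite (le_trans _ (ltW tn))//.
      by rewrite lef_pV2 ?posrE// ler_nat ltnS leq_maxl.
    rewrite (le_trans (ltW (truncnS_gt _)))// ler_nat ltnS.
    by rewrite (leq_trans (leq_maxr n _)).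
  by move=> [n _] /=; rewrite !in_itv/= andbT => /andP[+ _]; apply: lt_le_trans.
- by move=> t /D0; exact: f0.
- by move=> t /D0; exact: cf.
- by move=> t /D0; exact: dF.
apply: cvgB.
  apply: (cvg_comp _ _ _ Fl).
  apply/cvgryPge => A; near=> n; rewrite (@le_trans _ _ n%:R)// ?ler_nat//.
    by near: n; exact: nbhs_infty_ger.
  by rewrite (leq_trans (leqnSn _)).
have /cvg_at_rightP := Fa; apply; split => [n|]; first by rewrite invr_gt0.
exact: cvg_harmonic.
Unshelve. all: end_near. Qed.

Lemma ge0_integral_shift (c : R) (f : R -> \bar R) :
  measurable_fun [set: R] f -> (forall x, 0 <= f x)%E ->
  (\int[leb]_x f (x + c)%R = \int[leb]_x f x)%E.
Proof.
move=> mf f0.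
pose shift : measurableTypeR R -> measurableTypeR R := fun x : R => x + c.
have mshift : measurable_fun setT shift by exact: measurable_funD.
(* the image of Lebesgue measure under [shift], as a measure *)
pose nu : {measure set (measurableTypeR R) -> \bar R} :=
  measure_function_pushforward__canonical__measure_function_Measure leb mshift.
have nuE (A : set (measurableTypeR R)) : measurable A -> nu A = leb A.
  move=> mA; apply/esym/(@lebesgue_measure_unique _ nu) => // _ [[a b]] _ <-.
  rewrite /= /pushforward (_ : _ @^-1` _ = `]a - c, b - c]%classic); last first.
    by apply/seteqP; split=> x /=; rewrite !in_itv/= ltrBlDr lerBrDr.
  rewrite !lebesgue_measure_itv/= !lte_fin ltrD2r.
  by case: ifP => // _; rewrite -!EFinD; congr EFin; ring.
rewrite [RHS](_ : _ = \int[nu]_x f x)%E.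
  by rewrite ge0_integral_pushforward.
by apply: eq_measure_integral => A mA _; exact/esym/nuE.
Qed.

Lemma measurable_funV d (T : measurableType d) (D : set T) (f : T -> R) :
  measurable_fun D f -> measurable_fun D (fun x => (f x)^-1).
Proof.
(* since [0^-1 = 0], the equation also holds where [f] vanishes *)
move=> mf; have -> : (fun x => (f x)^-1) = (fun x => f x * (f x ^+ 2) `^ (-1)).
  apply/funext => x; rewrite powR_inv1 ?sqr_ge0//.
  have [->|fx0] := eqVneq (f x) 0; first by rewrite invr0 mul0r.
  by rewrite expr2 invfM mulrA mulfV// mul1r.
apply: measurable_funM => //.
apply: (@measurableT_comp _ _ _ _ _ _ (@powR R ^~ (-1))).
  exact: measurable_powR.
exact: measurable_funX.
Qed.

End primitives.

Section subordination.
Context {R : realType}.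
Notation leb := (@lebesgue_measure R).

Lemma continuous_powRl (p t : R) :
  0 < t -> {for t, continuous (fun t : R => t `^ p)}.
Proof.
move=> t0; apply/differentiable_continuous/derivable1_diffP.
by apply: derivable_powR; rewrite in_itv/= t0.
Qed.

(** The derivative of [t |-> atan (c * t `^ p)]: an explicit integrable function
    of order [t `^ (p - 1)] at [0] and [t `^ (- p - 1)] at infinity, by which
    every integral on the half-line below is dominated. *)
Definition atan_density (c p t : R) : R :=
  c * (p * t `^ (p - 1)) / (1 + (c * t `^ p) ^+ 2).

Lemma atan_density_ge0 (c p t : R) : 0 <= c -> 0 <= p -> 0 <= atan_density c p t.
Proof.
move=> c0 p0; rewrite divr_ge0//; last by rewrite addr_ge0// sqr_ge0.
by rewrite mulr_ge0// mulr_ge0// powR_ge0.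
Qed.

Lemma measurable_atan_density (c p : R) :
  measurable_fun [set: R] (atan_density c p).
Proof.
apply: measurable_funM.
  by apply: measurable_funM => //; exact: measurable_funM.
apply: measurable_funV; apply: measurable_funD => //.
by apply: measurable_funX; exact: measurable_funM.
Qed.

Lemma integral_atan_density (c p : R) : 0 < c -> 0 < p ->
  (\int[leb]_(t in `]0%R, +oo[) (atan_density c p t)%:E = (pi / 2)%:E)%E.
Proof.
move=> c0 p0.
rewrite -[pi / 2]subr0.
apply: (@ge0_integral0y_primitive _ _ (fun t => atan (c * t `^ p))).
- by move=> t t0; rewrite atan_density_ge0// ltW.
- move=> t t0.
  apply: cvgM.
    by apply: cvgM; [exact: cvg_cst|apply: cvgM; [exact: cvg_cst|exact: continuous_powRl]].
  apply: cvgV; first by rewrite gt_eqF// ltr_pwDl// sqr_ge0.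
  apply: cvgD; first exact: cvg_cst.
  by apply: cvgM; (apply: cvgM; [exact: cvg_cst|exact: continuous_powRl]).
- move=> t t0; have := is_derive1_powR p t0 => dp.
  have dcp : is_derive t 1 (fun t : R => c * t `^ p) (c * (p * t `^ (p - 1))).
    exact: is_deriveZ.
  have := @is_derive1_comp _ atan _ t _ _ (is_derive1_atan _) dcp.
  by rewrite mulrC.
- rewrite -[X in _ --> X]atan0 -[X in atan X](mulr0 c).
  apply: continuous_cvg; first exact: continuous_atan.
  by apply: cvgM; [exact: cvg_cst|exact: powR_cvg0].
- apply: (@cvg_comp _ _ _ _ _ _ (+oo%R : set_system R)); last exact: cvgy_atan.
  apply/cvgryPge => A.
  near=> t.
  have t0 : 0 < t by near: t; exact: nbhs_pinfty_gt.
  have A0 : 0 <= `|A| / c by rewrite divr_ge0// ltW.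
  have tA : (`|A| / c) `^ p^-1 <= t by near: t; exact: nbhs_pinfty_ge.
  rewrite (le_trans (ler_norm A))// mulrC -ler_pdivrMr//.
  rewrite -(powRr1 A0) -(mulVf (lt0r_neq0 p0)) powRrM.
  by apply: ge0_ler_powR; rewrite ?nnegrE ?powR_ge0 ?(ltW p0)// ltW.
Unshelve. all: end_near. Qed.

(** * The one-sided stable law of index 1/2 *)

(** The density in [s] of the one-sided 1/2-stable law: the Poisson semigroup is
    the heat semigroup averaged against [stable y]. *)
Definition stable (y s : R) : R :=
  y / (2 * Num.sqrt pi) * (expR (- (y ^+ 2 / (4 * s))) / s `^ (3 / 2)).

Lemma stable_ge0 y s : 0 <= y -> 0 <= stable y s.
Proof.
by move=> y0; rewrite mulr_ge0// divr_ge0 ?expR_ge0 ?powR_ge0.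
Qed.

Lemma stable_gt0 y s : 0 < y -> 0 < s -> 0 < stable y s.
Proof.
move=> y0 s0; rewrite mulr_gt0// divr_gt0 ?expR_gt0 ?powR_gt0//.
by rewrite mulr_gt0 ?sqrtr_gt0 ?pi_gt0.
Qed.

Lemma powR32 (s : R) : 0 <= s -> s `^ (3 / 2) = s * Num.sqrt s.
Proof.
move=> s0; rewrite -powR12_sqrt// (_ : 3 / 2 = 1 + 2^-1 :> R); last by field.
rewrite powRD ?powRr1//; apply/implyP => /eqP; lra.
Qed.

Lemma measurable_stable y : measurable_fun [set: R] (stable y).
Proof.
apply: measurable_funM => //; apply: measurable_funM.
  apply: measurableT_comp => //; apply: measurableT_comp => //.
  apply: measurable_funM => //; apply: measurable_funV.
  exact: measurable_funM.
by apply: measurable_funV; exact: measurable_powR.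
Qed.

Let id_mfun : measurableTypeR R -> R := idfun.

HB.instance Definition _ :=
  @isMeasurableFun.Build _ _ _ _ id_mfun (@measurable_id _ _ setT).

(** The distribution function of a centred normal law is a primitive of a
    Gaussian whose limits at both ends are known. *)
Lemma normal_primitive (sigma : R) : sigma != 0 ->
  exists E : R -> R, [/\ forall x : R, is_derive x 1 E (normal_pdf 0 sigma x),
    E x @[x --> +oo%R] --> (1 : R) & E x @[x --> -oo%R] --> (0 : R)].
Proof.
move=> s0; pose X : {RV (normal_prob 0 sigma) >-> R} := id_mfun.
exists (fun x => fine (cdf X x)); split.
- move=> x.
  have ix : leb.-integrable [set` Interval -oo%O (BRight (x + 1))]
      (EFin \o normal_pdf 0 sigma).
    by apply: integrableS (integrable_normal_pdf 0 sigma) => //.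
  have xx1 : x < x + 1 by rewrite ltrDl.
  have [d dE] := continuous_FTC1 xx1 ix (ltNyr x)
    (@continuous_normal_pdf _ 0 _ s0 x).
  rewrite -dE derive1E; apply: DeriveDef; first exact: d.
  by [].
- exact/fine_cvg/(cvg_cdfy1 X).
- exact/fine_cvg/(cvg_cdfNy0 X).
Qed.

(** The mass is [1], but any bound independent of [y] serves: [expR (- x) <=
    (1 + x)^-1] turns the density into a multiple of [atan_density (2 / y) 2^-1]. *)
Lemma stable_mass_le y : 0 < y ->
  (\int[leb]_(s in `]0%R, +oo[) (stable y s)%:E <= (Num.sqrt pi)%:E)%E.
Proof.
move=> y0; have spi0 : 0 < Num.sqrt pi :> R by rewrite sqrtr_gt0 pi_gt0.
have c0 : 0 < 2 / y :> R by rewrite divr_gt0.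
have h0 : 0 < 2^-1 :> R by rewrite invr_gt0.
have /(congr1 (fun x => (2 / Num.sqrt pi)%:E * x)%E) := integral_atan_density c0 h0.
rewrite -EFinM (_ : 2 / _ * _ = Num.sqrt pi); last first.
  have : Num.sqrt pi ^+ 2 = pi :> R by rewrite sqr_sqrtr// pi_ge0.
  set r := Num.sqrt pi in spi0 *; move=> <-.
  by field; rewrite gt_eqF.
move=> <-.
rewrite -ge0_integralZl//; last 2 first.
- by apply/measurable_EFinP/measurable_funTS; exact: measurable_atan_density.
- by move=> s _; rewrite lee_fin atan_density_ge0 ?ltW.
apply: ge0_le_integral => //.
- by move=> s _; rewrite lee_fin stable_ge0// ltW.
- by apply/measurable_EFinP/measurable_funTS; exact: measurable_stable.
- apply/measurable_EFinP/measurable_funTS; apply: measurable_funM => //.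
  exact: measurable_atan_density.
move=> s; rewrite /= in_itv/= andbT => s0.
rewrite -EFinM lee_fin /stable /atan_density.
have r0 : 0 < Num.sqrt s by rewrite sqrtr_gt0.
rewrite powR32 ?(ltW s0)// powR12_sqrt ?(ltW s0)//.
rewrite (_ : 2^-1 - 1 = - 2^-1 :> R); last by field.
rewrite powRN powR12_sqrt ?(ltW s0)//.
set r := Num.sqrt s in r0 *; have sE : s = r ^+ 2 by rewrite sqr_sqrtr// ltW.
rewrite sE; set x := y ^+ 2 / (4 * r ^+ 2).
have x0 : 0 < x by rewrite divr_gt0 ?exprn_gt0// mulr_gt0// exprn_gt0.
have ex : expR (- x) <= (1 + x)^-1.
  rewrite expRN lef_pV2 ?posrE ?expR_gt0 ?expR_ge1Dx//.
  by rewrite addr_gt0.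
apply: (@le_trans _ _ (y / (2 * Num.sqrt pi) * ((1 + x)^-1 / (r ^+ 2 * r)))).
  rewrite ler_pM2l; last by rewrite divr_gt0// mulr_gt0.
  by rewrite ler_pM2r// invr_gt0 mulr_gt0// exprn_gt0.
rewrite le_eqVlt; apply/orP; left; apply/eqP; rewrite /x; field.
rewrite !gt_eqF//= ?addr_gt0 ?mulr_gt0 ?exprn_gt0//.
Qed.
End subordination.

Section convolution.
Context {R : realType}.
Notation leb := (@lebesgue_measure R).

Lemma continuous_stable (y s : R) : 0 < s -> {for s, continuous (stable y)}.
Proof.
move=> s0; apply: cvgM; first exact: cvg_cst.
apply: cvgM.
  apply: continuous_comp; last exact: continuous_expR.
  apply: cvgN; apply: cvgM; first exact: cvg_cst.
  apply: cvgV; first by rewrite gt_eqF// mulr_gt0.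
  by apply: cvgM; [exact: cvg_cst|exact: cvg_id].
apply: cvgV; first by rewrite gt_eqF// powR_gt0.
exact: continuous_powRl.
Qed.

(** The substitution [v = (u - 2 s) / sqrt (s (u - s))], for which
    [u ^ 2 / (s (u - s)) = v ^ 2 + 4], turns the integrand into a Gaussian
    in [v]; a primitive is therefore the distribution function of a normal law
    composed with [v]. *)
Lemma stable_convolution (y u : R) : 0 < y -> 0 < u ->
  (\int[leb]_(s in `]0%R, u[) (stable y s * stable y (u - s))%:E =
   (stable (2 * y) u)%:E)%E.
Proof.
move=> y0 u0.
have spi0 : 0 < Num.sqrt pi :> R by rewrite sqrtr_gt0 pi_gt0.
(* the standard deviation of the Gaussian in [v] *)
pose sigma := Num.sqrt (2 * u) / y.
have s2u : 0 < 2 * u by rewrite mulr_gt0.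
have sg0 : 0 < sigma by rewrite divr_gt0// sqrtr_gt0.
have sg2 : sigma ^+ 2 = 2 * u / y ^+ 2 by rewrite expr_div_n sqr_sqrtr// ltW.
have [E [dE Ey ENy]] := normal_primitive (lt0r_neq0 sg0).
pose q s := s * (u - s).
pose v s := (u - 2 * s) / Num.sqrt (q s).
have q_gt0 s : 0 < s < u -> 0 < q s.
  by move=> /andP[s0 su]; rewrite mulr_gt0// subr_gt0.
have dv s : 0 < s < u ->
    is_derive s 1 v (- (u ^+ 2 / (2 * (q s * Num.sqrt (q s))))).
  move=> /[dup] su /q_gt0 qs.
  have dq : is_derive s 1 q (u - 2 * s).
    have d2 : is_derive s 1 (fun s : R => u - s) (0 - 1).
      exact: is_deriveB.
    have d3 := @is_deriveM _ _ id (fun s => u - s) s 1 _ _ (is_derive_id _ _) d2.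
    have {d3} : is_derive s 1 q _ := d3.
    by move=> d3; apply: is_derive_eq d3 _; rewrite /GRing.scale/=; ring.
  have dn : is_derive s 1 (fun s : R => u - 2 * s) (- 2).
    have d2 : is_derive s 1 (fun s : R => 2 * s) (2 * 1) by exact: is_deriveZ.
    have : is_derive s 1 (fun s : R => u - 2 * s) (0 - 2 * 1).
      exact: is_deriveB.
    by rewrite mulr1 sub0r.
  have dsq : is_derive s 1 (fun s => Num.sqrt (q s))
      ((2 * Num.sqrt (q s))^-1 * (u - 2 * s)).
    exact: (@is_derive1_comp _ Num.sqrt q s _ _ (is_derive1_sqrt qs) dq).
  have sq0 : 0 < Num.sqrt (q s) by rewrite sqrtr_gt0.
  have dsqV := @is_deriveV _ (fun s => Num.sqrt (q s)) s _ 1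
    (lt0r_neq0 sq0) dsq.
  have dvs : is_derive s 1 v _ := is_deriveM dn dsqV; apply: is_derive_eq dvs _.
  have qE : Num.sqrt (q s) ^+ 2 = q s by rewrite sqr_sqrtr// ltW.
  have uE : u ^+ 2 = 4 * q s + (u - 2 * s) ^+ 2 by rewrite /q; ring.
  rewrite /GRing.scale/=; move: (Num.sqrt (q s)) sq0 qE => r r0 qE.
  by rewrite uE -qE; field; rewrite gt_eqF.
pose F s := - (stable (2 * y) u) * E (v s).
pose x_ (n : nat) : R := u / n.+3%:R.
have x0 n : 0 < x_ n by rewrite divr_gt0.
have x2 n : x_ n < u - x_ n.
  have : 2 * x_ n < u by rewrite /x_ mulrA ltr_pdivrMr// mulrC ltr_pM2l// ltr_nat.
  lra.
have D0 s : `]0, u[%classic s -> 0 < s < u by rewrite /= in_itv.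
have vsym s : v (u - s) = - v s.
  rewrite /v /q (_ : (u - s) * (u - (u - s)) = s * (u - s)); last by ring.
  by rewrite -[RHS]mulNr; congr (_ * _); ring.
apply: (@ge0_integral_bigcup_primitive R _ F _ x_ (fun n => u - x_ n)).
- exact: x2.
- move=> n m nm; rewrite ler_pM2l// lef_pV2 ?posrE// ler_nat.
  by rewrite !ltnS.
- move=> n m nm; rewrite lerB// ler_pM2l// lef_pV2 ?posrE// ler_nat.
  by rewrite !ltnS.
- apply/seteqP; split=> s /=.
    move=> /D0/andP[s0 su].
    have [n sn] := ltr_add_invr (divr_gt0 s0 u0).
    have us0 : 0 < u - s by rewrite subr_gt0.
    have [m sm] := ltr_add_invr (divr_gt0 us0 u0).
    exists (maxn n m) => //=; rewrite in_itv/= /x_.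
    have bnd k t : (k <= maxn n m)%N -> 0 + k.+1%:R^-1 < t / u ->
        u / (maxn n m).+3%:R <= t.
      move=> kn; rewrite add0r ltr_pdivlMr// => /ltW; apply: le_trans.
      rewrite mulrC ler_pM2r// lef_pV2 ?posrE// ler_nat.
      by rewrite ltnS (leq_trans kn)// leqW.
    rewrite (bnd n)//= ?leq_maxl//.
    by rewrite lerBrDr -lerBrDl; exact: bnd (leq_maxr _ _) sm.
  move=> [n _] /=; rewrite !in_itv/= => /andP[h1 h2]; apply/andP; split.
    exact: lt_le_trans h1.
  by rewrite (le_lt_trans h2)// ltrBlDr ltrDl.
- by move=> s _; rewrite mulr_ge0// stable_ge0// ltW.
- move=> s /D0/andP[s0 su]; apply: cvgM; first exact: continuous_stable.
  apply: (@continuous_comp _ _ _ (fun s => u - s) (stable y)).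
    by apply: cvgB; [exact: cvg_cst|exact: cvg_id].
  by apply: continuous_stable; rewrite subr_gt0.
- move=> s /D0/[dup] su /andP[s0 us].
  have us0 : 0 < u - s by rewrite subr_gt0.
  have dEv := @is_derive1_comp _ E v s _ _ (dE (v s)) (dv s su).
  have : is_derive s 1 F (- stable (2 * y) u * (normal_pdf 0 sigma (v s) *
      (- (u ^+ 2 / (2 * (q s * Num.sqrt (q s))))))).
    exact: is_deriveZ.
  move=> dF; apply: is_derive_eq dF _.
  rewrite normal_pdfE ?gt_eqF// /normal_fun /normal_peak subr0.
  have qs := q_gt0 _ su.
  have qE : Num.sqrt (q s) ^+ 2 = q s by rewrite sqr_sqrtr// ltW.
  have uE : u ^+ 2 = 4 * q s + (u - 2 * s) ^+ 2 by rewrite /q; ring.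
  have v2 : v s ^+ 2 = u ^+ 2 / q s - 4.
    rewrite /v expr_div_n qE uE; field; rewrite gt_eqF//.
  rewrite v2 sg2 /stable !powR32 ?(ltW s0) ?(ltW us0) ?(ltW u0)//.
  rewrite (_ : Num.sqrt (_ / _ * pi *+ 2) = 2 * Num.sqrt pi * Num.sqrt u / y);
    last first.
    rewrite (_ : _ *+ 2 = (2 / y) ^+ 2 * (pi * u)); last first.
      by rewrite -mulr_natl; field; rewrite gt_eqF.
    rewrite sqrtrM ?sqr_ge0// sqrtr_sqr ger0_norm ?divr_ge0 ?(ltW y0)//.
    by rewrite sqrtrM ?pi_ge0//; field; rewrite gt_eqF.
  have sqE : Num.sqrt (q s) = Num.sqrt s * Num.sqrt (u - s).
    by rewrite sqrtrM// ltW.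
  have eE : expR (- (y ^+ 2 / (4 * s))) * expR (- (y ^+ 2 / (4 * (u - s)))) =
      expR (- ((2 * y) ^+ 2 / (4 * u))) *
      expR (- (u ^+ 2 / q s - 4) / (2 * u / y ^+ 2 *+ 2)).
    rewrite -!expRD; congr expR; rewrite /q -mulr_natl; field.
    by rewrite !gt_eqF.
  rewrite sqE; move: eE; set e2 := expR (- (y ^+ 2 / (4 * s))).
  set e3 := expR (- (y ^+ 2 / (4 * (u - s)))).
  set e4 := expR (- ((2 * y) ^+ 2 / _)); set e1 := expR _ => eE.
  have zE : Num.sqrt u ^+ 2 = u by rewrite sqr_sqrtr// ltW.
  have a0 : 0 < Num.sqrt s by rewrite sqrtr_gt0.
  have b0 : 0 < Num.sqrt (u - s) by rewrite sqrtr_gt0.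
  have z0 : 0 < Num.sqrt u by rewrite sqrtr_gt0.
  move: zE a0 b0 z0 spi0; move: (Num.sqrt u) (Num.sqrt s) (Num.sqrt (u - s))
    (Num.sqrt pi) => z a b w zE a0 b0 z0 w0.
  transitivity (y ^+ 2 * (e2 * e3) / (4 * w ^+ 2 * q s * (a * b)) * (u / z ^+ 2)).
    by rewrite eE; field; rewrite !gt_eqF.
  rewrite zE mulfV ?gt_eqF// mulr1 /q; field.
  by rewrite !gt_eqF.
- have vy : v (x_ n) @[n --> \oo] --> +oo%R.
    apply/cvgryPge => A; near=> n.
    have n1 : n.+1%:R = n%:R + 1 :> R by rewrite -natr1.
    have n2 : n.+2%:R = n%:R + 2 :> R by rewrite -!natr1; ring.
    have n3 : n.+3%:R = n%:R + 3 :> R by rewrite -!natr1; ring.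
    have n30 : n%:R + 3 != 0 :> R by rewrite -n3.
    have -> : v (x_ n) = n.+1%:R / Num.sqrt n.+2%:R.
      rewrite /v /q (_ : x_ n * _ = (u / n.+3%:R) ^+ 2 * n.+2%:R); last first.
        by rewrite /x_ n3 n2; field.
      rewrite sqrtrM ?sqr_ge0// sqrtr_sqr ger0_norm ?divr_ge0 ?(ltW u0)//.
      have : Num.sqrt n.+2%:R != 0 :> R by rewrite gt_eqF// sqrtr_gt0.
      move: (Num.sqrt _) => r r0; rewrite /x_ n3 n1; field.
      by rewrite r0 n30 gt_eqF.
    rewrite ler_pdivlMr ?sqrtr_gt0//.
    rewrite (le_trans (ler_wpM2r _ (ler_norm A))) ?sqrtr_ge0//.
    rewrite -sqrtr_sqr -sqrtrM ?sqr_ge0//.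
    have -> : n.+1%:R = Num.sqrt (n.+1%:R ^+ 2) :> R.
      by rewrite sqrtr_sqr ger0_norm.
    rewrite ler_sqrt ?sqr_ge0//.
    have : 2 * A ^+ 2 <= n.+1%:R.
      rewrite (@le_trans _ _ n%:R)// ?ler_nat//.
      by near: n; exact: nbhs_infty_ger.
    have : 0 <= A ^+ 2 by rewrite sqr_ge0.
    rewrite n2 n1; have : 0 <= n%:R :> R by [].
    by move: (n%:R) (A ^+ 2) => N B *; nra.
  have E1 : E (v (x_ n)) @[n --> \oo] --> (1 : R).
    exact: (cvg_comp (fun n => v (x_ n)) E vy Ey).
  have E0 : E (- v (x_ n)) @[n --> \oo] --> (0 : R).
    apply: (cvg_comp (fun n => - v (x_ n)) E _ ENy).
    exact/cvgNrNy.
  have -> : (fun n => F (u - x_ n) - F (x_ n)) =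
      (fun n => stable (2 * y) u * (E (v (x_ n)) - E (- v (x_ n)))).
    by apply/funext => n; rewrite /F vsym; ring.
  have E10 : E (v (x_ n)) - E (- v (x_ n)) @[n --> \oo] --> (1 - 0 : R).
    exact: cvgB.
  rewrite subr0 in E10; have := cvgM (cvg_cst (stable (2 * y) u)) E10.
  by rewrite mulr1; apply.
Unshelve. all: end_near. Qed.
End convolution.

Section stable_semigroup.
Context {R : realType}.
Notation leb := (@lebesgue_measure R).

(** Subordination turns any semigroup into a semigroup: after a translation and
    Tonelli, the double average of a function of the sum of the two times is its
    average against the convolution square of the density. *)
Lemma ge0_integral_stable2 (y : R) (H : R -> \bar R) : 0 < y ->
  measurable_fun [set: R] H -> (forall u, 0 <= H u)%E ->
  (\int[leb]_(s in `]0%R, +oo[) ((stable y s)%:E *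
     \int[leb]_(r in `]0%R, +oo[) ((stable y r)%:E * H (r + s)%R)) =
   \int[leb]_(u in `]0%R, +oo[) ((stable (2 * y) u)%:E * H u))%E.
Proof.
move=> y0 mH H0.
pose e s : \bar R := ((EFin \o stable y) \_ `]0, +oo[) s.
have e0 s : (0 <= e s)%E.
  by apply: erestrict_ge0 => t _; rewrite lee_fin stable_ge0// ltW.
have me : measurable_fun [set: R] e.
  apply/(measurable_restrictT _ _).1 => //.
  by apply/measurable_EFinP/measurable_funTS; exact: measurable_stable.
have epos s : 0 < s -> e s = (stable y s)%:E.
  by move=> s0; rewrite /e patchE mem_set//= in_itv/= s0.
have eneg s : s <= 0 -> e s = 0%E.
  by move=> s0; rewrite /e patchE memNset//= in_itv/= ltNge s0.
have toT (G : R -> \bar R) : (\int[leb]_(s in `]0%R, +oo[) ((stable y s)%:E * G s)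
    = \int[leb]_s (e s * G s))%E.
  rewrite integral_mkcond; apply: eq_integral => s _.
  rewrite patchE; case: ifPn => [|]; rewrite ?inE ?notin_setE/= in_itv/= andbT.
    by move=> /epos ->.
  by move=> /negP; rewrite -leNgt => /eneg ->; rewrite mul0e.
rewrite toT.
under eq_integral => s _.
  rewrite toT -(ge0_integral_shift (- s)); last 2 first.
  - apply: emeasurable_funM => //; apply: measurableT_comp => //.
    exact: measurable_funD.
  - by move=> r; rewrite mule_ge0.
  under eq_integral do rewrite subrK.
  rewrite -ge0_integralZl//; last 2 first.
  - apply: emeasurable_funM => //; apply: measurableT_comp => //.
    exact: measurable_funD.
  - by move=> r _; rewrite mule_ge0.
  over.
rewrite /= (@fubini_tonelli _ _ _ _ _ leb leb
  (fun p : R * R => e p.1 * (e (p.2 - p.1)%R * H p.2))%E); last 2 first.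
- apply: emeasurable_funM; first exact: measurableT_comp.
  apply: emeasurable_funM; last exact: measurableT_comp.
  by apply: measurableT_comp => //; exact: measurable_funB.
- by move=> p; rewrite !mule_ge0.
rewrite [RHS]integral_mkcond; apply: eq_integral => u _ /=.
under eq_integral do rewrite muleA.
rewrite ge0_integralZr//; last 2 first.
- apply: emeasurable_funM => //; apply: measurableT_comp => //.
  exact: measurable_funB.
- by move=> r _; rewrite mule_ge0.
rewrite patchE; case: ifPn => [|]; rewrite ?inE ?notin_setE/= in_itv/= andbT.
  move=> u0; congr (_ * _)%E; rewrite -stable_convolution//.
  rewrite [RHS]integral_mkcond; apply: eq_integral => s _.
  rewrite patchE; case: ifPn => [|]; rewrite ?inE ?notin_setE/= in_itv/=.
    by move=> /andP[s0 su]; rewrite !epos ?subr_gt0.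
  move=> /negP; rewrite negb_and -!leNgt => /orP[/eneg ->|us].
    by rewrite mul0e.
  by rewrite (eneg (u - s)) ?mule0// subr_le0.
move=> /negP; rewrite -leNgt => u0.
rewrite integral0_eq ?mul0e// => s _.
have [s0|s0] := leP s 0; first by rewrite eneg// mul0e.
by rewrite (eneg (u - s)) ?mule0// subr_le0 (le_trans u0)// ltW.
Qed.

End stable_semigroup.

(** * Lebesgue measure on row vectors *)

Section lebesgue_rV_integrals.
Context {R : realType}.
Notation leb := (@lebesgue_measure R).

Lemma rV_consE (n : nat) (a : R) (w : 'rV[R]_n) :
  (rV_cons (a, w)) ord0 ord0 = a /\
  forall j, (rV_cons (a, w)) ord0 (lift ord0 j) = w ord0 j.
Proof. by split => [|j]; rewrite mxE ?unlift_none// liftK. Qed.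

Lemma ge0_integral_rVS (n : nat) (f : 'rV[R]_n.+1 -> \bar R) :
  measurable_fun [set: 'rV[R]_n.+1] f -> (forall x, 0 <= f x)%E ->
  (\int[lebesgue_rV]_x f x =
   \int[leb]_a \int[lebesgue_rV]_w f (rV_cons (a, w)))%E.
Proof.
move=> mf f0.
rewrite (_ : (\int[lebesgue_rV]_x f x)%E = (\int[pushforward
    (leb \x @lebesgue_rV R n)%E (@rV_cons R n)]_x f x)%E)//.
rewrite ge0_integral_pushforward//; last exact: measurable_rV_cons.
rewrite preimage_setT fubini_tonelli1//; last by move=> p; exact: f0.
by apply: measurableT_comp => //; exact: measurable_rV_cons.
Qed.

Lemma measurable_rV_sum d (T : measurableType d) (n : nat)
    (f : 'I_n -> T -> R) : (forall i, measurable_fun [set: T] (f i)) ->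
  measurable_fun [set: T] (fun x => \sum_i f i x).
Proof. by move=> mf; apply: measurable_sum. Qed.

(** Each coordinate contributes the mass of a normal density of variance
    [A^-1]. *)
Lemma integral_gauss_rV (n : nat) (A : R) (b : 'rV[R]_n) : 0 < A ->
  (\int[lebesgue_rV]_w
     (expR (- (A / 2 * \sum_i (w ord0 i - b ord0 i) ^+ 2)))%:E =
   ((2 * pi / A) `^ (n%:R / 2))%:E)%E.
Proof.
move=> A0; elim: n b => [|n IH] b.
  rewrite [LHS](@integral_dirac _ _ (0 : 'rV[R]_0) R)//; last first.
    apply/measurable_EFinP; apply: measurableT_comp => //.
    apply: measurableT_comp => //; apply: measurable_funM => //.
    by apply: measurable_rV_sum => -[].
  by rewrite diracT mul1e big_ord0 mulr0 oppr0 expR0 mul0r powRr0.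
rewrite ge0_integral_rVS; last 2 first.
- apply/measurable_EFinP; apply: measurableT_comp => //.
  apply: measurableT_comp => //; apply: measurable_funM => //.
  apply: measurable_rV_sum => i; apply: measurable_funX.
  by apply: measurable_funB => //; exact: measurable_rV_coord.
- by move=> x; rewrite lee_fin expR_ge0.
have pA : 0 < 2 * pi / A by rewrite divr_gt0// mulr_gt0// pi_gt0.
pose b' : 'rV[R]_n := \row_j b ord0 (lift ord0 j).
pose sg := (Num.sqrt A)^-1.
have sg0 : sg != 0 by rewrite invr_eq0 gt_eqF// sqrtr_gt0.
have sg2 : sg ^+ 2 = A^-1 by rewrite exprVn sqr_sqrtr// ltW.
have step a (w : 'rV[R]_n) :
    expR (- (A / 2 * \sum_i (rV_cons (a, w) ord0 i - b ord0 i) ^+ 2)) =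
    expR (- (A / 2 * (a - b ord0 ord0) ^+ 2)) *
    expR (- (A / 2 * \sum_j (w ord0 j - b' ord0 j) ^+ 2)).
  rewrite big_ord_recl; have [-> wE] := rV_consE a w.
  rewrite mulrDr opprD expRD; congr (_ * expR (- (_ * _))).
  by apply: eq_bigr => j _; rewrite wE mxE.
under eq_integral => a _.
  under eq_integral do rewrite step EFinM.
  rewrite /= ge0_integralZl ?lee_fin ?expR_ge0//; last first.
    apply/measurable_EFinP; apply: measurableT_comp => //.
    apply: measurableT_comp => //; apply: measurable_funM => //.
    apply: measurable_rV_sum => i; apply: measurable_funX.
    by apply: measurable_funB => //; exact: measurable_rV_coord.
  rewrite IH.
  rewrite (_ : expR _ = (2 * pi / A) `^ 2^-1 * normal_pdf (b ord0 ord0) sg a);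
    last first.
    rewrite normal_pdfE// /normal_peak powR12_sqrt ?(ltW pA)// [RHS]mulrA.
    rewrite (_ : sg ^+ 2 * pi *+ 2 = 2 * pi / A); last first.
      by rewrite sg2 -mulr_natl; ring.
    rewrite mulfV ?mul1r ?gt_eqF ?sqrtr_gt0//.
    rewrite /normal_fun sg2; congr expR; rewrite -mulr_natl; field.
    by rewrite gt_eqF.
  rewrite EFinM -muleA (muleC (normal_pdf _ _ _)%:E) muleA.
  over.
rewrite /= ge0_integralZl ?mule_ge0 ?lee_fin ?powR_ge0//; last 2 first.
- by apply/measurable_EFinP; exact: measurable_normal_pdf.
- by move=> w _; rewrite lee_fin normal_pdf_ge0.
rewrite integral_normal_pdf mule1 -EFinM -powRD; last first.
  by apply/implyP => _; rewrite gt_eqF.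
by congr (_ `^ _)%:E; rewrite -natr1; field.
Qed.

Definition rV_box (n : nat) (x : 'rV[R]_n) (e : R) : set 'rV[R]_n :=
  [set z | forall i, `|z ord0 i - x ord0 i| < e].

Lemma measurable_rV_box (n : nat) (x : 'rV[R]_n) (e : R) :
  measurable (rV_box x e).
Proof.
rewrite (_ : rV_box x e = \bigcap_(i in [set: 'I_n])
    ((fun z : 'rV[R]_n => z ord0 i) @^-1` `]x ord0 i - e, x ord0 i + e[)).
  apply: fin_bigcap_measurable => // i _; rewrite -[X in measurable X]setTI.
  exact: measurable_rV_coord.
apply/seteqP; split=> z /= h i; first by move=> _ /=; rewrite in_itv/= -ltr_distl.
by have := h i I; rewrite /= in_itv/= -ltr_distl.
Qed.

Lemma lebesgue_rV_box_gt0 (n : nat) (x : 'rV[R]_n) (e : R) : 0 < e ->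
  (0 < lebesgue_rV (rV_box x e))%E.
Proof.
move=> e0; elim: n x => [|n IH] x.
  have -> : rV_box x e = setT by apply/seteqP; split => // z _ [].
  by rewrite [X in (_ < X)%E]diracT lte01.
pose x' : 'rV[R]_n := \row_j x ord0 (lift ord0 j).
have -> : lebesgue_rV (rV_box x e) = (leb \x @lebesgue_rV R n)%E
    (`]x ord0 ord0 - e, x ord0 ord0 + e[%classic `*` rV_box x' e).
  rewrite /= /pushforward; congr (product_measure1 _ _ _).
  apply/seteqP; split=> -[a w]/= h.
    have [h0 hS] := rV_consE a w; split=> [|j].
      by rewrite in_itv/= -ltr_distl -[X in X - _]h0; exact: h.
    by rewrite mxE -hS; exact: h.
  have [h0 hS] := rV_consE a w; case: h => ha hw i.
  case: (unliftP ord0 i) => [j ->|->].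
    by rewrite hS; have := hw j; rewrite mxE.
  by rewrite h0; move: ha; rewrite in_itv/= -ltr_distl.
rewrite product_measure1E//; last exact: measurable_rV_box.
apply: mule_gt0; last exact: IH.
rewrite /= lebesgue_measure_itv/= lte_fin.
have -> : x ord0 ord0 - e < x ord0 ord0 + e by lra.
by rewrite -EFinD lte_fin; lra.
Qed.

End lebesgue_rV_integrals.

(** * The Mehler kernel *)

Section mehler.
Context {R : realType}.
Notation leb := (@lebesgue_measure R).
Implicit Types (s r a b : R).

Lemma sinh_gt0 s : 0 < s -> 0 < sinh s.
Proof.
by move=> s0; rewrite divr_gt0// subr_gt0 ltr_expR; lra.
Qed.

Lemma cosh_gt0 s : 0 < cosh s.
Proof. by rewrite divr_gt0// addr_gt0// expR_gt0. Qed.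

Lemma sinh2 s : sinh (2 * s) = 2 * sinh s * cosh s.
Proof.
rewrite /sinh /cosh (_ : 2 * s = s + s); last by ring.
by rewrite opprD !expRD; field.
Qed.

Lemma tanh_ge0 s : 0 < s -> 0 <= tanh s.
Proof. by move=> s0; rewrite divr_ge0 ?ltW ?cosh_gt0 ?sinh_gt0. Qed.

Lemma coth_gt0 s : 0 < s -> 0 < coth s.
Proof. by move=> s0; rewrite divr_gt0 ?cosh_gt0 ?sinh_gt0. Qed.

Lemma cosh_ge1 s : 1 <= cosh s.
Proof.
rewrite /cosh expRN; have e0 := expR_gt0 s; move: (expR s) e0 => e e0.
have : 0 <= (e - 1) ^+ 2 / e by rewrite divr_ge0 ?sqr_ge0// ltW.
rewrite (_ : _ / e = e + e^-1 - 2); last by field; rewrite gt_eqF.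
by lra.
Qed.

(** In the form [(2 s)^-1 <= coth s] this is what makes the Gaussian tails of the
    kernel small at small times. *)
Lemma tanh_le s : 0 < s -> tanh s <= 2 * s.
Proof.
move=> s0; rewrite /tanh ler_pdivrMr ?cosh_gt0//.
have h := expR_ge1Dx (- (2 * s)).
have -> : sinh s = expR s * (1 - expR (- (2 * s))) / 2.
  rewrite /sinh mulrBr mulr1 -expRD; congr ((_ - expR _) / 2); ring.
have e0 := expR_gt0 s; have e1 := expR_gt0 (- s).
rewrite /cosh mulrA ler_pM2r//.
have : 1 - expR (- (2 * s)) <= 2 * s by lra.
move: (expR (- (2 * s))) => q hq.
apply: (@le_trans _ _ (expR s * (2 * s))); first by rewrite ler_pM2l.
by rewrite mulrC ler_pM2l ?mulr_gt0//; lra.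
Qed.

(** The exponent of the kernel is a sum over the coordinates, so that the
    identities it satisfies reduce to dimension one. *)
Definition mehler_exponent s a b : R :=
  - ((a - b) ^+ 2 / 4 * coth s + (a + b) ^+ 2 / 4 * tanh s).

Lemma euclid_sqr n (x : 'rV[R]_n) : euclid x ^+ 2 = \sum_i x ord0 i ^+ 2.
Proof. by rewrite sqr_sqrtr// sumr_ge0// => i _; rewrite sqr_ge0. Qed.

Lemma mehler_kernelE n s (x z : 'rV[R]_n) : mehler_kernel s x z =
  expR (\sum_i mehler_exponent s (x ord0 i) (z ord0 i)) /
  (2 * pi * sinh (2 * s)) `^ (n%:R / 2).
Proof.
rewrite /mehler_kernel -expRD !euclid_sqr; congr (expR _ / _).
rewrite -opprD !mulr_suml -big_split/= -sumrN; apply: eq_bigr => i _.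
by rewrite !mxE.
Qed.

Lemma mehler_exponent_le s a b : 0 < s ->
  mehler_exponent s a b <= - ((a - b) ^+ 2 / 4 * coth s).
Proof.
move=> s0; rewrite lerN2 lerDl mulr_ge0 ?tanh_ge0//.
by rewrite divr_ge0// sqr_ge0.
Qed.

Lemma mehler_kernel_ge0 n s (x z : 'rV[R]_n) : 0 <= mehler_kernel s x z.
Proof. by rewrite mehler_kernelE divr_ge0 ?expR_ge0 ?powR_ge0. Qed.

Lemma mehler_normalizer_gt0 s : 0 < s -> 0 < 2 * pi * sinh (2 * s).
Proof.
by move=> s0; rewrite mulr_gt0 ?sinh_gt0 ?mulr_gt0// pi_gt0.
Qed.

Lemma mehler_kernel_gt0 n s (x z : 'rV[R]_n) : 0 < s -> 0 < mehler_kernel s x z.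
Proof.
move=> s0; rewrite mehler_kernelE divr_gt0 ?expR_gt0// powR_gt0//.
exact: mehler_normalizer_gt0.
Qed.

Lemma measurable_sinh : measurable_fun [set: R] (@sinh R).
Proof.
rewrite /sinh; apply: measurable_funM => //; apply: measurable_funB => //.
exact: measurableT_comp.
Qed.

Lemma measurable_cosh : measurable_fun [set: R] (@cosh R).
Proof.
rewrite /cosh; apply: measurable_funM => //; apply: measurable_funD => //.
exact: measurableT_comp.
Qed.

Lemma measurable_mehler_kernel d (T : measurableType d) n
    (sg : T -> R) (x z : T -> 'rV[R]_n) :
  measurable_fun [set: T] sg ->
  (forall i, measurable_fun [set: T] (fun t => x t ord0 i)) ->
  (forall i, measurable_fun [set: T] (fun t => z t ord0 i)) ->
  measurable_fun [set: T] (fun t => mehler_kernel (sg t) (x t) (z t)).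
Proof.
move=> ms mx mz; under eq_fun do rewrite mehler_kernelE.
have msh : measurable_fun setT (fun t => sinh (sg t)).
  by apply: measurableT_comp ms; exact: measurable_sinh.
have mch : measurable_fun setT (fun t => cosh (sg t)).
  by apply: measurableT_comp ms; exact: measurable_cosh.
apply: measurable_funM.
  apply: measurableT_comp => //; apply: measurable_rV_sum => i.
  apply: measurableT_comp => //; apply: measurable_funD.
    apply: measurable_funM.
      by apply: measurable_funM => //; apply: measurable_funX;
        apply: measurable_funB; [exact: mx|exact: mz].
    by apply: measurable_funM => //; exact: measurable_funV.
  apply: measurable_funM.
    by apply: measurable_funM => //; apply: measurable_funX;
      apply: measurable_funD; [exact: mx|exact: mz].
  by apply: measurable_funM => //; exact: measurable_funV.
apply: measurable_funV.
apply: (@measurableT_comp _ _ _ _ _ _ (@powR R ^~ (n%:R / 2))).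
  exact: measurable_powR.
apply: measurable_funM => //.
apply: (@measurableT_comp _ _ _ _ _ _ (@sinh R)); first exact: measurable_sinh.
exact: measurable_funM.
Qed.

(** The Chapman-Kolmogorov identity before integration: completing the square
    in the middle variable. *)
Lemma mehler_exponentD s r a b c : 0 < s -> 0 < r ->
  mehler_exponent s a c + mehler_exponent r c b =
  - (sinh (2 * (s + r)) / (sinh (2 * s) * sinh (2 * r)) / 2 *
     (c - (a * sinh (2 * r) + b * sinh (2 * s)) / sinh (2 * (s + r))) ^+ 2) +
  mehler_exponent (s + r) a b.
Proof.
move=> s0 r0; rewrite /mehler_exponent /coth /tanh /sinh /cosh.
rewrite (_ : 2 * (s + r) = s + s + (r + r)); last by ring.
rewrite (_ : 2 * s = s + s); last by ring.
rewrite (_ : 2 * r = r + r); last by ring.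
rewrite !opprD !expRD !expRN.
(* in [u = expR s] and [v = expR r] this is an identity of rational functions *)
have := s0; have := r0; rewrite -!expR_gt1.
move: (expR s) (expR r) => u v v1 u1.
have gt1M p q : 1 < p -> 1 < q -> 1 < p * q :> R.
  by move=> p1 q1; rewrite (lt_trans p1)// ltr_pMr// (lt_trans _ p1).
have ne1 p : 1 < p -> (p - 1 != 0 :> R) && (p + 1 != 0 :> R) && (p != 0 :> R).
  by move=> p1; rewrite !gt_eqF; lra.
have /andP[/andP[n1 n2] n3] := ne1 _ v1; have /andP[/andP[m1 m2] m3] := ne1 _ u1.
have uu1 := gt1M _ _ u1 u1; have vv1 := gt1M _ _ v1 v1.
have uv1 := gt1M _ _ u1 v1.
have /andP[/andP[a1 a2] _] := ne1 _ (gt1M _ _ uv1 uv1).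
have /andP[/andP[b1 b2] _] := ne1 _ (gt1M _ _ uu1 uu1).
have /andP[/andP[c1 c2] _] := ne1 _ (gt1M _ _ vv1 vv1).
have uuvv1 := gt1M _ _ uu1 vv1.
have /andP[/andP[d1 d2] _] := ne1 _ (gt1M _ _ uuvv1 uuvv1).
have /andP[/andP[e1 e2] _] := ne1 _ uu1.
have /andP[/andP[f1 f2] _] := ne1 _ vv1.
by field; rewrite n3 m3 a1 a2 b1 c1 d1 e1 e2 f1 f2.
Qed.

Lemma mehler_kernel_semigroup n s r (x z : 'rV[R]_n) : 0 < s -> 0 < r ->
  (\int[lebesgue_rV]_w (mehler_kernel s x w * mehler_kernel r w z)%:E =
   (mehler_kernel (s + r) x z)%:E)%E.
Proof.
move=> s0 r0.
have S0 := mehler_normalizer_gt0 s0; have R0 := mehler_normalizer_gt0 r0.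
have sr0 : 0 < s + r by rewrite addr_gt0.
have SR0 := mehler_normalizer_gt0 sr0.
have h0 (t : R) : 0 < t -> 0 < sinh (2 * t) by move=> t0; rewrite sinh_gt0// mulr_gt0.
pose A := sinh (2 * (s + r)) / (sinh (2 * s) * sinh (2 * r)).
have A0 : 0 < A by apply: divr_gt0; [|apply: mulr_gt0]; exact: h0.
pose b : 'rV[R]_n := \row_i ((x ord0 i * sinh (2 * r) + z ord0 i * sinh (2 * s)) /
  sinh (2 * (s + r))).
pose k := expR (\sum_i mehler_exponent (s + r) (x ord0 i) (z ord0 i)) /
  ((2 * pi * sinh (2 * s)) `^ (n%:R / 2) * (2 * pi * sinh (2 * r)) `^ (n%:R / 2)).
have kE w : mehler_kernel s x w * mehler_kernel r w z =
    k * expR (- (A / 2 * \sum_i (w ord0 i - b ord0 i) ^+ 2)).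
  rewrite !mehler_kernelE mulf_div -expRD -big_split/=.
  under eq_bigr do rewrite mehler_exponentD//.
  rewrite big_split/= expRD sumrN -mulr_sumr /k [RHS]mulrAC; congr (_ / _).
  rewrite [RHS]mulrC; congr (expR (- (_ * _)) * _).
  by apply: eq_bigr => i _; rewrite mxE.
under eq_integral do rewrite kE EFinM.
rewrite ge0_integralZl//; last 2 first.
- apply/measurable_EFinP; apply: measurableT_comp => //.
  apply: measurableT_comp => //; apply: measurable_funM => //.
  apply: measurable_rV_sum => i; apply: measurable_funX.
  by apply: measurable_funB => //; exact: measurable_rV_coord.
- by rewrite lee_fin divr_ge0 ?expR_ge0// mulr_ge0// powR_ge0.
rewrite integral_gauss_rV// -EFinM mehler_kernelE /k mulrAC -mulrA.
congr (_ * _)%:E; rewrite -powRM ?(ltW S0) ?(ltW R0)//.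
rewrite (_ : 2 * pi * sinh (2 * s) * _ =
  2 * pi * sinh (2 * (s + r)) * (2 * pi / A)); last first.
  by rewrite /A; field; rewrite !gt_eqF ?h0.
have pA : 0 < 2 * pi / A by rewrite divr_gt0// mulr_gt0// pi_gt0.
rewrite (@powRM _ (2 * pi * sinh (2 * (s + r))) (2 * pi / A)) ?(ltW SR0) ?(ltW pA)//.
have simp (P Q : R) : P != 0 -> P / (Q * P) = Q^-1.
  by move=> P0; rewrite invfM mulrCA mulfV ?mulr1.
by apply: simp; rewrite gt_eqF// powR_gt0.
Qed.

(** Dropping the [tanh] factor leaves a Gaussian; with [lambda = 1] this bounds
    the mass of the kernel, and [lambda < 1] leaves room to absorb the decay
    away from [x]. *)
Lemma integral_mehler_gauss_le n s lambda (x : 'rV[R]_n) : 0 < s -> 0 < lambda ->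
  (\int[lebesgue_rV]_z
     (expR (- (lambda * coth s / 2 / 2 * \sum_i (z ord0 i - x ord0 i) ^+ 2)) /
      (2 * pi * sinh (2 * s)) `^ (n%:R / 2))%:E <=
   (lambda^-1 `^ (n%:R / 2))%:E)%E.
Proof.
move=> s0 l0; have S0 := mehler_normalizer_gt0 s0.
have c0 := coth_gt0 s0.
have A0 : 0 < lambda * coth s / 2 by rewrite divr_gt0// mulr_gt0.
under eq_integral do rewrite EFinM.
rewrite ge0_integralZr//; last 2 first.
- apply/measurable_EFinP; apply: measurableT_comp => //.
  apply: measurableT_comp => //; apply: measurable_funM => //.
  apply: measurable_rV_sum => i; apply: measurable_funX.
  by apply: measurable_funB => //; exact: measurable_rV_coord.
- by rewrite lee_fin invr_ge0 powR_ge0.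
rewrite integral_gauss_rV// -EFinM lee_fin ler_pdivrMr ?powR_gt0//.
have l1 : 0 <= lambda^-1 by rewrite invr_ge0 ltW.
rewrite -powRM ?(ltW S0)//.
have pi0 := @pi_gt0 R.
apply: ge0_ler_powR; rewrite ?nnegrE.
- by rewrite divr_ge0.
- by rewrite ltW// divr_gt0// mulr_gt0.
- by apply: mulr_ge0 => //; exact: ltW.
have sh := sinh_gt0 s0; have ch := cosh_gt0 s; have ch1 := cosh_ge1 s.
rewrite sinh2 /coth.
rewrite (_ : 2 * pi / _ = lambda^-1 * (4 * pi * sinh s * (cosh s)^-1)); last first.
  by field; rewrite !gt_eqF.
rewrite ler_wpM2l// (_ : 2 * pi * _ = 4 * pi * sinh s * cosh s); last by ring.
apply: ler_wpM2l.
  by apply: mulr_ge0; [apply: mulr_ge0 => //; exact: ltW|exact: ltW].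
by rewrite (le_trans _ ch1)// invf_le1.
Qed.

Lemma mehler_kernel_le n s (x z : 'rV[R]_n) : 0 < s ->
  mehler_kernel s x z <=
  expR (- (coth s / 4 * \sum_i (z ord0 i - x ord0 i) ^+ 2)) /
  (2 * pi * sinh (2 * s)) `^ (n%:R / 2).
Proof.
move=> s0; rewrite mehler_kernelE ler_pM2r; last first.
  by rewrite invr_gt0 powR_gt0// mehler_normalizer_gt0.
rewrite ler_expR mulr_sumr -sumrN ler_sum// => i _.
rewrite (le_trans (mehler_exponent_le _ _ s0))// lerN2.
by rewrite le_eqVlt; apply/orP; left; apply/eqP; field.
Qed.

End mehler.

(** * The heat and Poisson semigroups *)

Section heat.
Context {R : realType} (n : nat).
Notation leb := (@lebesgue_measure R).
Notation ST := (R * 'rV[R]_n)%type.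
Implicit Types (u v : ST -> R) (p : ST) (s r y : R).

(** The semigroup generated by the parabolic operator, since [d/dt] generates the
    translations in time. *)
Definition heat u p s : R :=
  \int[lebesgue_rV]_z (mehler_kernel s p.2 z * u (p.1 - s, z)).

(** [stable y] extended by [0], so that Tonelli applies on the whole line. *)
Definition stable0 (y : R) : R -> R := stable y \_ `]0%R, +oo[.

Lemma stable0_ge0 y s : 0 < y -> 0 <= stable0 y s.
Proof.
by move=> y0; apply: restrict_ge0 => r _; rewrite stable_ge0// ltW.
Qed.

Lemma measurable_stable0 y : measurable_fun [set: R] (stable0 y).
Proof.
apply/(measurable_restrictT _ _).1 => //; apply: measurable_funTS.
exact: measurable_stable.
Qed.

Definition bounded_nonneg (M : R) u : Prop :=
  measurable_fun [set: ST] u /\ forall p, 0 <= u p <= M.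

Section bounded.
Context (M : R) (u : ST -> R) (Hu : bounded_nonneg M u).

Let mfu : measurable_fun [set: ST] u := Hu.1.
Let u0 p : 0 <= u p. Proof. by have /andP[] := Hu.2 p. Qed.
Let uM p : u p <= M. Proof. by have /andP[] := Hu.2 p. Qed.
Let M0 : 0 <= M. Proof. exact: le_trans (u0 (0, 0)) (uM (0, 0)). Qed.

Lemma heat_ge0 p s : 0 <= heat u p s.
Proof. by apply: Rintegral_ge0 => z _; rewrite mulr_ge0// mehler_kernel_ge0. Qed.

Lemma measurable_heat_integrand :
  measurable_fun [set: (ST * R) * 'rV[R]_n]
    (fun q => mehler_kernel q.1.2 q.1.1.2 q.2 * u (q.1.1.1 - q.1.2, q.2)).
Proof.
have m1 : measurable_fun [set: (ST * R) * 'rV[R]_n] (fun q => q.1).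
  exact: measurable_fst.
have m11 : measurable_fun [set: (ST * R) * 'rV[R]_n] (fun q => q.1.1).
  exact: (measurableT_comp measurable_fst m1).
have m12 : measurable_fun [set: (ST * R) * 'rV[R]_n] (fun q => q.1.2).
  exact: (measurableT_comp measurable_snd m1).
have m112 : measurable_fun [set: (ST * R) * 'rV[R]_n] (fun q => q.1.1.2).
  exact: (measurableT_comp measurable_snd m11).
apply: measurable_funM.
  apply: measurable_mehler_kernel => //.
  - by move=> i; exact: (measurableT_comp (measurable_rV_coord i) m112).
  - by move=> i; exact: (measurableT_comp (measurable_rV_coord i) measurable_snd).
apply: (measurableT_comp mfu); apply: measurable_fun_pair => //.
apply: measurable_funB => //; exact: (measurableT_comp measurable_fst m11).
Qed.

Lemma measurable_heat_section p s :
  measurable_fun [set: 'rV[R]_n]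
    (fun z => mehler_kernel s p.2 z * u (p.1 - s, z)).
Proof.
exact: (measurableT_comp measurable_heat_integrand
  (pair1_measurable (p, s))).
Qed.

Lemma integral_heat_le p s : 0 < s ->
  (\int[lebesgue_rV]_z (mehler_kernel s p.2 z * u (p.1 - s, z))%:E <= M%:E)%E.
Proof.
move=> s0.
have g0 : (0 < (2 * pi * sinh (2 * s)) `^ (n%:R / 2)).
  by rewrite powR_gt0// mehler_normalizer_gt0.
pose G (z : 'rV[R]_n) := expR (- (1 * coth s / 2 / 2 * \sum_i (z ord0 i - p.2 ord0 i) ^+ 2)) /
  (2 * pi * sinh (2 * s)) `^ (n%:R / 2).
have mG : measurable_fun [set: 'rV[R]_n] G.
  apply: measurable_funM => //; apply: measurableT_comp => //.
  apply: measurableT_comp => //; apply: measurable_funM => //.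
  apply: measurable_rV_sum => i; apply: measurable_funX.
  by apply: measurable_funB => //; exact: measurable_rV_coord.
have G0 z : 0 <= G z by rewrite divr_ge0 ?expR_ge0// ltW.
apply: (@le_trans _ _ (\int[lebesgue_rV]_z (M%:E * (G z)%:E))%E).
  apply: ge0_le_integral => //.
  - by move=> z _; rewrite lee_fin mulr_ge0// mehler_kernel_ge0.
  - by apply/measurable_EFinP; exact: measurable_heat_section.
  - by apply/measurable_EFinP; exact: measurable_funM.
  move=> z _; rewrite -EFinM lee_fin mulrC ler_pM ?mehler_kernel_ge0//.
  rewrite (le_trans (mehler_kernel_le _ _ s0))// /G.
  by rewrite (_ : 1 * coth s / 2 / 2 = coth s / 4)//; field.
rewrite ge0_integralZl ?lee_fin//; last 2 first.
- exact/measurable_EFinP.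
- by move=> z _; rewrite lee_fin.
rewrite -[leRHS]mule1 lee_wpmul2l ?lee_fin//.
have := @integral_mehler_gauss_le _ n s 1 p.2 s0 ltr01.
by rewrite invr1 powR1.
Qed.

Lemma heatE p s : 0 < s -> (heat u p s)%:E =
  (\int[lebesgue_rV]_z (mehler_kernel s p.2 z * u (p.1 - s, z))%:E)%E.
Proof.
move=> s0; rewrite /heat /Rintegral fineK// ge0_fin_numE; last first.
  by apply: integral_ge0 => z _; rewrite lee_fin mulr_ge0// mehler_kernel_ge0.
by rewrite (le_lt_trans (integral_heat_le p s0))// ltry.
Qed.

Lemma integrable_heat p s : 0 < s ->
  (@lebesgue_rV R n).-integrable setT
    (EFin \o (fun z => mehler_kernel s p.2 z * u (p.1 - s, z))).
Proof.
move=> s0; apply/integrableP; split.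
  by apply/measurable_EFinP; exact: measurable_heat_section.
rewrite (le_lt_trans _ (ltry M))// (le_trans _ (integral_heat_le p s0))//.
apply: ge0_le_integral => //.
- apply: measurableT_comp => //.
  by apply/measurable_EFinP; exact: measurable_heat_section.
- by apply/measurable_EFinP; exact: measurable_heat_section.
- by move=> z _; rewrite /= lee_fin ger0_norm// mulr_ge0// mehler_kernel_ge0.
Qed.

Lemma heat_le p s : 0 < s -> heat u p s <= M.
Proof. by move=> s0; rewrite -lee_fin heatE// integral_heat_le. Qed.

Lemma measurable_heat :
  measurable_fun [set: ST * R] (fun q => heat u q.1 q.2).
Proof.
apply: (@measurableT_comp _ _ _ _ _ _ (@fine R)) => //.
apply: (@measurable_fun_fubini_tonelli_F _ _ _ _ _ (@lebesgue_rV R n)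
  (EFin \o (fun q => mehler_kernel q.1.2 q.1.1.2 q.2 * u (q.1.1.1 - q.1.2, q.2)))).
- by apply/measurable_EFinP; exact: measurable_heat_integrand.
- by move=> q; rewrite /= lee_fin mulr_ge0// mehler_kernel_ge0.
Qed.

Lemma measurable_heat_time p : measurable_fun [set: R] (heat u p).
Proof.
exact: (measurableT_comp measurable_heat (pair1_measurable p)).
Qed.

Lemma measurable_stable_heat y p :
  measurable_fun [set: R] (fun s => stable y s * heat u p s).
Proof.
apply: measurable_funM; first exact: measurable_stable.
exact: measurable_heat_time.
Qed.

Lemma integral_stable_heat_le y p : 0 < y ->
  (\int[leb]_(s in `]0%R, +oo[) (stable y s * heat u p s)%:E <=
   (M * Num.sqrt pi)%:E)%E.
Proof.
move=> y0.
apply: (@le_trans _ _ (\int[leb]_(s in `]0%R, +oo[) (M%:E * (stable y s)%:E))%E).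
  apply: ge0_le_integral => //.
  - by move=> s _; rewrite lee_fin mulr_ge0 ?heat_ge0// stable_ge0// ltW.
  - by apply/measurable_EFinP/measurable_funTS; exact: measurable_stable_heat.
  - apply/measurable_EFinP/measurable_funTS; apply: measurable_funM => //.
    exact: measurable_stable.
  move=> s; rewrite /= in_itv/= andbT => s0.
  by rewrite -EFinM lee_fin mulrC ler_wpM2r ?heat_le// stable_ge0// ltW.
rewrite ge0_integralZl ?lee_fin//; last 2 first.
- by apply/measurable_EFinP/measurable_funTS; exact: measurable_stable.
- by move=> s _; rewrite lee_fin stable_ge0// ltW.
by rewrite EFinM lee_wpmul2l ?lee_fin// stable_mass_le.
Qed.

Lemma integrable_stable_heat y p : 0 < y ->
  leb.-integrable `]0, +oo[ (EFin \o (fun s => stable y s * heat u p s)).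
Proof.
move=> y0; apply/integrableP; split.
  by apply/measurable_EFinP/measurable_funTS; exact: measurable_stable_heat.
rewrite (le_lt_trans _ (ltry (M * Num.sqrt pi)))//.
rewrite (le_trans _ (integral_stable_heat_le p y0))//.
apply: ge0_le_integral => //.
- apply: measurableT_comp => //.
  by apply/measurable_EFinP/measurable_funTS; exact: measurable_stable_heat.
- by apply/measurable_EFinP/measurable_funTS; exact: measurable_stable_heat.
- move=> s _; rewrite /= lee_fin ger0_norm// mulr_ge0 ?heat_ge0//.
  by rewrite stable_ge0// ltW.
Qed.

Lemma poissonE y p : 0 < y ->
  poisson y u p = \int[leb]_(s in `]0, +oo[) (stable y s * heat u p s).
Proof.
move=> y0; rewrite /poisson.
have c0 : y / (2 * Num.sqrt pi) != 0.
  by rewrite gt_eqF// divr_gt0// mulr_gt0// sqrtr_gt0 pi_gt0.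
have iE : leb.-integrable `]0, +oo[ (EFin \o (fun s =>
    (y / (2 * Num.sqrt pi))^-1 * (stable y s * heat u p s))).
  have := integrable_stable_heat p y0.
  by move=> /(integrableZl _ (y / (2 * Num.sqrt pi))^-1); apply.
rewrite (_ : (fun s => stable y s * heat u p s) = (fun s =>
    y / (2 * Num.sqrt pi) * ((y / (2 * Num.sqrt pi))^-1 *
    (stable y s * heat u p s)))); last by apply/funext => s; rewrite mulVKf.
rewrite RintegralZl//; congr (_ * _).
apply: eq_Rintegral => s; rewrite inE/= in_itv/= andbT => s0.
transitivity (expR (- (y ^+ 2 / (4 * s))) / s `^ (3 / 2) * heat u p s);
  last by rewrite /stable -(mulrA (y / _)) mulKf.
rewrite [RHS]mulrAC; congr (_ / _).
rewrite /heat -RintegralZl//; last exact: integrable_heat.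
by apply: eq_Rintegral => z _; rewrite mulrA.
Qed.

Lemma poissonEFin y p : 0 < y -> (poisson y u p)%:E =
  (\int[leb]_(s in `]0%R, +oo[) ((stable y s)%:E * (heat u p s)%:E))%E.
Proof.
move=> y0; rewrite poissonE// /Rintegral fineK//.
by apply: integrable_fin_num => //; exact: integrable_stable_heat.
Qed.

Lemma poisson_ge0 y p : 0 < y -> 0 <= poisson y u p.
Proof.
move=> y0; rewrite poissonE//; apply: Rintegral_ge0 => s _.
by rewrite mulr_ge0 ?heat_ge0// stable_ge0// ltW.
Qed.

Lemma poisson_le y p : 0 < y -> poisson y u p <= M * Num.sqrt pi.
Proof.
by move=> y0; rewrite -lee_fin poissonEFin//; exact: integral_stable_heat_le.
Qed.

Lemma poissonT y p : 0 < y -> (poisson y u p)%:E =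
  (\int[leb]_s (stable0 y s * heat u p s)%:E)%E.
Proof.
move=> y0; rewrite poissonEFin// integral_mkcond.
apply: eq_integral => s _; rewrite /stable0 !patchE; case: ifPn => //.
by rewrite mul0r.
Qed.

Lemma measurable_poisson y : 0 < y -> measurable_fun [set: ST] (poisson y u).
Proof.
move=> y0; apply/measurable_EFinP.
rewrite (_ : EFin \o _ = fun p => \int[leb]_s
   (stable0 y s * heat u p s)%:E)%E; last first.
  by apply/funext => p /=; rewrite poissonT.
apply: (@measurable_fun_fubini_tonelli_F _ _ _ _ _ leb
  (EFin \o (fun q : ST * R => stable0 y q.2 * heat u q.1 q.2))).
- apply/measurable_EFinP; apply: measurable_funM; last exact: measurable_heat.
  exact: (measurableT_comp (measurable_stable0 y) measurable_snd).
- by move=> q; rewrite /= lee_fin mulr_ge0 ?heat_ge0// stable0_ge0.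
Qed.

Lemma bounded_nonneg_poisson y : 0 < y ->
  bounded_nonneg (M * Num.sqrt pi) (poisson y u).
Proof.
move=> y0; split; first exact: measurable_poisson.
by move=> p; rewrite poisson_ge0// poisson_le.
Qed.

Lemma heat_semigroup p s r : 0 < s -> 0 < r ->
  (\int[lebesgue_rV]_z (mehler_kernel s p.2 z * heat u (p.1 - s, z) r)%:E =
   (heat u p (s + r))%:E)%E.
Proof.
move=> s0 r0; have sr0 : 0 < s + r by rewrite addr_gt0.
have mcoord := @measurable_rV_coord _ R n.
have mu2 : measurable_fun [set: 'rV[R]_n * 'rV[R]_n]
    (fun q => u (p.1 - s - r, q.2)).
  by apply: (measurableT_comp mfu); exact: measurable_fun_pair.
have mK2 : measurable_fun [set: 'rV[R]_n * 'rV[R]_n]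
    (fun q => mehler_kernel r q.1 q.2).
  apply: measurable_mehler_kernel => // i.
    exact: (measurableT_comp (mcoord i) measurable_fst).
  exact: (measurableT_comp (mcoord i) measurable_snd).
have mK1 : measurable_fun [set: 'rV[R]_n * 'rV[R]_n]
    (fun q => mehler_kernel s p.2 q.1).
  apply: measurable_mehler_kernel => // i.
  exact: (measurableT_comp (mcoord i) measurable_fst).
have mKz w : measurable_fun [set: 'rV[R]_n] (fun z => mehler_kernel r w z).
  by apply: measurable_mehler_kernel.
have mKw w : measurable_fun [set: 'rV[R]_n] (fun z => mehler_kernel r z w).
  by apply: measurable_mehler_kernel.
have mKs : measurable_fun [set: 'rV[R]_n] (fun z => mehler_kernel s p.2 z).
  by apply: measurable_mehler_kernel.
have muw : measurable_fun [set: 'rV[R]_n] (fun z => u (p.1 - s - r, z)).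
  by apply: (measurableT_comp mfu); exact: measurable_fun_pair.
under eq_integral => z _.
  rewrite EFinM heatE//= -ge0_integralZl ?lee_fin ?mehler_kernel_ge0//;
    last 2 first.
  - by apply/measurable_EFinP; exact: (measurable_funM (mKz z) muw).
  - by move=> w _; rewrite lee_fin mulr_ge0// mehler_kernel_ge0.
  over.
rewrite /= (@fubini_tonelli _ _ _ _ _ (@lebesgue_rV R n) (@lebesgue_rV R n)
  (fun q => (mehler_kernel s p.2 q.1)%:E *
     (mehler_kernel r q.1 q.2 * u (p.1 - s - r, q.2))%:E)%E); last 2 first.
- apply: emeasurable_funM; first exact/measurable_EFinP.
  by apply/measurable_EFinP; exact: (measurable_funM mK2 mu2).
- move=> q; apply: mule_ge0; first by rewrite lee_fin mehler_kernel_ge0.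
  by rewrite lee_fin mulr_ge0// mehler_kernel_ge0.
rewrite heatE//; apply: eq_integral => w _ /=.
under eq_integral do rewrite -EFinM mulrA EFinM.
rewrite ge0_integralZr ?lee_fin//; last 2 first.
- by apply/measurable_EFinP; exact: (measurable_funM mKs (mKw w)).
- by move=> z _; rewrite lee_fin mulr_ge0 ?mehler_kernel_ge0.
by rewrite mehler_kernel_semigroup// -EFinM opprD addrA.
Qed.

End bounded.

(** The semigroup law of [heat] makes the double average a function of the sum
    of the two times, to which subordination applies. *)
Lemma poisson_semigroup M u y p : bounded_nonneg M u -> 0 < y ->
  poisson y (poisson y u) p = poisson (2 * y) u p.
Proof.
move=> Hu y0; have y20 : 0 < 2 * y by rewrite mulr_gt0.
have HPu := bounded_nonneg_poisson Hu y0.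
apply: EFin_inj; rewrite [RHS](poissonEFin Hu p y20) [LHS](poissonEFin HPu p y0).
rewrite -(@ge0_integral_stable2 _ _ (EFin \o heat u p)) //; last 2 first.
- by apply/measurable_EFinP; exact: (measurable_heat_time Hu).
- by move=> s; rewrite /= lee_fin (heat_ge0 Hu).
apply: eq_integral => s; rewrite inE/= in_itv/= andbT => s0.
congr (_ * _)%E; rewrite (heatE HPu)//.
have mhs : measurable_fun [set: 'rV[R]_n * R]
    (fun q => heat u (p.1 - s, q.1) q.2).
  have mq : measurable_fun [set: 'rV[R]_n * R]
      (fun q => ((p.1 - s, q.1), q.2) : ST * R).
    by apply: measurable_fun_pair => //; exact: measurable_fun_pair.
  exact: (measurableT_comp (measurable_heat Hu) mq).
have mKs : measurable_fun [set: 'rV[R]_n * R] (fun q => mehler_kernel s p.2 q.1).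
  apply: measurable_mehler_kernel => // i.
  exact: (measurableT_comp (measurable_rV_coord i) measurable_fst).
have mst : measurable_fun [set: 'rV[R]_n * R] (fun q => stable0 y q.2).
  exact: (measurableT_comp (measurable_stable0 y) measurable_snd).
under eq_integral => z _.
  rewrite EFinM (poissonT Hu)// -ge0_integralZl ?lee_fin ?mehler_kernel_ge0//;
    last 2 first.
  - apply/measurable_EFinP; apply: (measurable_funM (measurable_stable0 y)).
    exact: (measurable_heat_time Hu).
  - by move=> r _; rewrite lee_fin mulr_ge0 ?(heat_ge0 Hu)// stable0_ge0.
  over.
rewrite /= (@fubini_tonelli _ _ _ _ _ (@lebesgue_rV R n) leb
  (fun q => (mehler_kernel s p.2 q.1)%:E *
     (stable0 y q.2 * heat u (p.1 - s, q.1) q.2)%:E)%E); last 2 first.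
- apply: emeasurable_funM; first exact/measurable_EFinP.
  by apply/measurable_EFinP; exact: (measurable_funM mst mhs).
- move=> q; apply: mule_ge0; first by rewrite lee_fin mehler_kernel_ge0.
  by rewrite lee_fin mulr_ge0 ?(heat_ge0 Hu)// stable0_ge0.
rewrite [RHS]integral_mkcond; apply: eq_integral => r _ /=.
rewrite /stable0 !patchE; case: ifPn => [|_]; last first.
  by rewrite integral0_eq// => z _; rewrite mul0r mule0.
rewrite inE/= in_itv/= andbT => r0.
have mKr : measurable_fun [set: 'rV[R]_n]
    (fun z => mehler_kernel s p.2 z * heat u (p.1 - s, z) r).
  apply: measurable_funM.
    by apply: measurable_mehler_kernel => // i; exact: measurable_rV_coord.
  exact: (measurableT_comp mhs (pair2_measurable r)).
transitivity ((stable y r)%:E * \int[lebesgue_rV]_z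
    (mehler_kernel s p.2 z * heat u (p.1 - s, z) r)%:E)%E; last first.
  by rewrite (addrC r s); congr (_ * _)%E; exact: (heat_semigroup Hu p s0 r0).
rewrite -ge0_integralZl//; last 3 first.
- exact/measurable_EFinP.
- by move=> z _; rewrite lee_fin mulr_ge0 ?(heat_ge0 Hu) ?mehler_kernel_ge0.
- by rewrite lee_fin stable_ge0// ltW.
apply: eq_integral => z _; rewrite -!EFinM; congr EFin; ring.
Qed.

(** Only times up to [p.1] enter, so a function may be modified in the future;
    below it is replaced by its positive part. *)
Lemma poisson_past u v y p :
  (forall t x, t <= p.1 -> u (t, x) = v (t, x)) ->
  poisson y u p = poisson y v p.
Proof.
move=> uv; congr (_ * _); apply: eq_Rintegral => s; rewrite inE/= in_itv/= andbT => s0.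
congr (_ / _); apply: eq_Rintegral => z _; congr (_ * _); apply: uv.
by rewrite lerBlDr lerDl ltW.
Qed.

Lemma poissonB M N u v y p : bounded_nonneg M u -> bounded_nonneg N v -> 0 < y ->
  poisson y (fun q => u q - v q) p = poisson y u p - poisson y v p.
Proof.
move=> Hu Hv y0; rewrite (poissonE Hu)// (poissonE Hv)// -RintegralB//; last 2 first.
- exact: (integrable_stable_heat Hu).
- exact: (integrable_stable_heat Hv).
have iE : leb.-integrable `]0, +oo[ (EFin \o (fun s =>
    stable y s * heat u p s - stable y s * heat v p s)).
  rewrite (_ : _ \o _ = (EFin \o (fun s => stable y s * heat u p s)%R) \-
    (EFin \o (fun s => stable y s * heat v p s)%R))%E; last first.
    by apply/funext => s /=; rewrite EFinB.
  apply: integrableB => //; first exact: (integrable_stable_heat Hu).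
  exact: (integrable_stable_heat Hv).
have c0 : y / (2 * Num.sqrt pi) != 0.
  by rewrite gt_eqF// divr_gt0// mulr_gt0// sqrtr_gt0 pi_gt0.
rewrite [RHS](_ : _ = \int[leb]_(s in `]0, +oo[)
    (y / (2 * Num.sqrt pi) * ((y / (2 * Num.sqrt pi))^-1 *
    (stable y s * heat u p s - stable y s * heat v p s)))); last first.
  by apply: eq_Rintegral => s _; rewrite mulVKf.
rewrite RintegralZl//; last first.
  by move: iE => /(integrableZl _ (y / (2 * Num.sqrt pi))^-1); apply.
congr (_ * _); apply: eq_Rintegral => s; rewrite inE/= in_itv/= andbT => s0.
transitivity (expR (- (y ^+ 2 / (4 * s))) / s `^ (3 / 2) *
    (heat u p s - heat v p s)).
  rewrite [RHS]mulrAC; congr (_ / _).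
  rewrite /heat -RintegralB//; last 2 first.
  - exact: (integrable_heat Hu).
  - exact: (integrable_heat Hv).
  rewrite -RintegralZl//; last first.
    rewrite (_ : _ \o _ = (EFin \o (fun z => mehler_kernel s p.2 z * u (p.1 - s, z))%R) \-
      (EFin \o (fun z => mehler_kernel s p.2 z * v (p.1 - s, z))%R))%E; last first.
      by apply/funext => z /=; rewrite EFinB.
    apply: integrableB => //; first exact: (integrable_heat Hu).
    exact: (integrable_heat Hv).
  by apply: eq_Rintegral => z _; rewrite -mulrA mulrBr.
by rewrite -mulrBr /stable -(mulrA (y / _)) mulKf.
Qed.

End heat.

(** * Derivatives of the Poisson integral in its parameter *)

Section poisson_moments.
Context {R : realType}.
Notation leb := (@lebesgue_measure R).
Implicit Types (g : R -> R) (q k : nat) (y s c M : R).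

Lemma powMexpR_le (k : nat) (c x : R) : 0 < c -> 0 <= x ->
  x ^+ k * expR (- (c * x)) <= k`!%:R / c ^+ k.
Proof.
move=> c0 x0.
have cx : 0 <= c * x by rewrite mulr_ge0// ltW.
have h : (c * x) ^+ k / k`!%:R <= expR (c * x).
  case: k => [|k]; first by rewrite expr0 fact0 divr1 (le_trans _ (expR_ge1Dx _))// lerDl.
  by rewrite (le_trans _ (expR_ge1Dxn k cx))// lerDr.
rewrite expRN ler_pdivrMr ?expR_gt0// mulrAC ler_pdivlMr ?exprn_gt0//.
rewrite -exprMn (mulrC x) (mulrC _%:R).
by move: h; rewrite ler_pdivrMr// ltr0n fact_gt0.
Qed.

Definition profile M g : Prop :=
  measurable_fun [set: R] g /\ forall s, 0 < s -> 0 <= g s <= M.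

(** Each derivative in [y] of the Poisson integral of a profile [g] is a
    combination, with polynomial coefficients, of these moments. *)
Definition moment_kernel q y s : R :=
  expR (- (y ^+ 2 / (4 * s))) / s `^ (3 / 2) * s^-1 ^+ q.

Definition moment g q y : R :=
  \int[leb]_(s in `]0, +oo[) (moment_kernel q y s * g s).

Lemma moment_kernel_ge0 q y s : 0 < s -> 0 <= moment_kernel q y s.
Proof.
move=> s0; rewrite mulr_ge0 ?divr_ge0 ?expR_ge0 ?powR_ge0//.
by rewrite exprn_ge0// invr_ge0 ltW.
Qed.

(** The factor [2] compensates the exponent [2^-1], which is a factor of
    [atan_density 1 2^-1]. *)
Definition moment_bound q c : R :=
  2 * (q.+1`!%:R / (c ^+ 2 / 4) ^+ q.+1 + q`!%:R / (c ^+ 2 / 4) ^+ q).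

Lemma moment_bound_ge0 q c : 0 <= moment_bound q c.
Proof.
by rewrite mulr_ge0// addr_ge0// divr_ge0// exprn_ge0// divr_ge0// sqr_ge0.
Qed.

(** Uniform in [y >= c]: this is the domination needed to differentiate under
    the integral sign. *)
Lemma moment_kernel_le q c y s : 0 < c -> c <= y -> 0 < s ->
  moment_kernel q y s <= moment_bound q c * atan_density 1 2^-1 s.
Proof.
move=> c0 cy s0; rewrite /moment_kernel /atan_density.
have r0 : 0 < Num.sqrt s by rewrite sqrtr_gt0.
rewrite powR32 ?(ltW s0)// powR12_sqrt ?(ltW s0)//.
rewrite (_ : 2^-1 - 1 = - 2^-1 :> R); last by field.
rewrite powRN powR12_sqrt ?(ltW s0)// !mul1r sqr_sqrtr ?(ltW s0)//.
set r := Num.sqrt s in r0 *.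
have x0 : 0 <= s^-1 by rewrite invr_ge0 ltW.
have k0 : 0 < c ^+ 2 / 4 by rewrite divr_gt0// exprn_gt0.
have ele : expR (- (y ^+ 2 / (4 * s))) <= expR (- (c ^+ 2 / 4 * s^-1)).
  rewrite ler_expR lerN2 invfM mulrA ler_wpM2r// ler_wpM2r ?invr_ge0//.
  by rewrite ler_sqr ?nnegrE// ltW// (lt_le_trans c0).
have h1 := powMexpR_le q.+1 k0 x0; have h2 := powMexpR_le q k0 x0.
have s10 : 0 < 1 + s by rewrite addr_gt0.
rewrite (_ : moment_bound q c * _ =
  (q.+1`!%:R / (c ^+ 2 / 4) ^+ q.+1 + q`!%:R / (c ^+ 2 / 4) ^+ q) / (r * (1 + s)));
  last first.
  rewrite /moment_bound; move: (_ / _) (_ / _ ^+ q) => a b.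
  by field; rewrite !gt_eqF.
rewrite ler_pdivlMr ?mulr_gt0//.
apply: le_trans (lerD h1 h2).
rewrite (_ : _ * (r * _) =
  expR (- (y ^+ 2 / (4 * s))) * (s^-1 ^+ q.+1 + s^-1 ^+ q)); last first.
  by rewrite (exprS s^-1 q); move: (s^-1 ^+ q) => b; field; rewrite !gt_eqF.
rewrite -mulrDl mulrC ler_wpM2l//.
by rewrite addr_ge0 ?exprn_ge0.
Qed.

Lemma measurable_moment_kernel q y : measurable_fun [set: R] (moment_kernel q y).
Proof.
apply: measurable_funM.
  apply: measurable_funM.
    apply: measurableT_comp => //; apply: measurableT_comp => //.
    by apply: measurable_funM => //; apply: measurable_funV; exact: measurable_funM.
  by apply: measurable_funV; exact: measurable_powR.
by apply: measurable_funX; exact: measurable_funV.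
Qed.

Lemma integrable_atan_density (k p : R) : 0 < p ->
  leb.-integrable `]0, +oo[ (EFin \o (fun s => k * atan_density 1 p s)).
Proof.
move=> p0.
have : leb.-integrable `]0, +oo[ (EFin \o (fun s => atan_density 1 p s)).
  apply/integrableP; split.
    by apply/measurable_EFinP/measurable_funTS; exact: measurable_atan_density.
  rewrite (_ : (\int[leb]_(x in _) _)%E = (pi / 2)%:E) ?ltry//.
  rewrite -(integral_atan_density ltr01 p0); apply: eq_integral => s _ /=.
  by rewrite ger0_norm// atan_density_ge0// ltW.
by move=> /(integrableZl _ k); apply.
Qed.

Section profile.
Context (M : R) (g : R -> R) (gM : profile M g).

Let mgE q y s : 0 < s -> `|moment_kernel q y s * g s| = moment_kernel q y s * g s.
Proof.
move=> s0; have /andP[g0 _] := gM.2 _ s0.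
by apply: ger0_norm; apply: mulr_ge0 => //; exact: moment_kernel_ge0.
Qed.

Let mg_le q c y s : 0 < c -> c <= y -> 0 < s ->
  moment_kernel q y s * g s <= M * moment_bound q c * atan_density 1 2^-1 s.
Proof.
move=> c0 cy s0; have /andP[g0 gs] := gM.2 _ s0.
rewrite mulrC -[leRHS]mulrA; apply: ler_pM => //; first exact: moment_kernel_ge0.
exact: moment_kernel_le.
Qed.

Lemma integrable_moment q y : 0 < y ->
  leb.-integrable `]0, +oo[ (EFin \o (fun s => moment_kernel q y s * g s)).
Proof.
move=> y0; have h0 : 0 < 2^-1 :> R by rewrite invr_gt0.
apply: (le_integrable _ _ _
  (integrable_atan_density (M * moment_bound q y) h0)) => //.
  apply/measurable_EFinP/measurable_funTS; apply: measurable_funM; last exact: gM.1.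
  exact: measurable_moment_kernel.
move=> s; rewrite /= in_itv/= andbT => s0.
rewrite lee_fin (le_trans _ (ler_norm _))//.
by rewrite mgE// mg_le.
Qed.

Lemma moment_le q c y : 0 < c -> c <= y ->
  `|moment g q y| <= M * moment_bound q c * (pi / 2).
Proof.
move=> c0 cy; have y0 := lt_le_trans c0 cy.
have h0 : 0 < 2^-1 :> R by rewrite invr_gt0.
rewrite (le_trans (le_normr_Rintegral _ (integrable_moment q y0)))//.
have -> : M * moment_bound q c * (pi / 2) =
    \int[leb]_(s in `]0, +oo[) (M * moment_bound q c * atan_density 1 2^-1 s).
  rewrite RintegralZl//; last first.
    have := integrable_atan_density 1 h0.
    by apply: eq_integrable => // s _ /=; rewrite mul1r.
  by rewrite /Rintegral (integral_atan_density ltr01 h0).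
apply: le_Rintegral => //.
- have := integrable_moment q y0; move=> /(integrable_abse); apply: eq_integrable => //.
- exact: integrable_atan_density.
move=> s; rewrite /= in_itv/= andbT => s0.
by rewrite mgE// mg_le.
Qed.

Lemma is_derive_moment_kernel q y s : s != 0 ->
  is_derive y 1 (fun y => moment_kernel q y s * g s)
    (- (y / 2) * (moment_kernel q.+1 y s * g s)).
Proof.
move=> s0.
have d1 : is_derive y 1 (fun y : R => - ((4 * s)^-1 * y ^+ 2))
    (- ((4 * s)^-1 * (2 * y))).
  have d0 : is_derive y 1 (fun y : R => y ^+ 2) (2 * y).
    have d : is_derive y 1 (fun y : R => y * y) _ :=
      @is_deriveM _ _ id id y 1 _ _ (is_derive_id _ _) (is_derive_id _ _).
    by apply: is_derive_eq d _; rewrite /GRing.scale/=; ring.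
  by apply: is_deriveN; exact: is_deriveZ.
have d2 : is_derive y 1 (fun y : R => expR (- ((4 * s)^-1 * y ^+ 2))) _ :=
  @is_derive1_comp _ expR _ y _ _ (is_derive_expR _) d1.
have d3 := is_deriveZ (s `^ (3 / 2))^-1 d2.
have {}d3 := is_deriveZ (s^-1 ^+ q * g s) d3.
have -> : (fun y => moment_kernel q y s * g s) =
    (s^-1 ^+ q * g s *: ((s `^ (3 / 2))^-1 *:
    (fun y : R => expR (- ((4 * s)^-1 * y ^+ 2))))).
  apply/funext => x; rewrite /moment_kernel (mulrC (x ^+ 2)).
  transitivity (s^-1 ^+ q * g s *
    ((s `^ (3 / 2))^-1 * expR (- ((4 * s)^-1 * x ^+ 2)))); last by [].
  ring.
apply: is_derive_eq d3 _; rewrite /moment_kernel (exprS s^-1).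
rewrite (mulrC (y ^+ 2)); move: (expR _) (s `^ _)^-1 (s^-1 ^+ q) => e a b.
transitivity (b * g s * (a * (e * (- ((4 * s)^-1 * (2 * y)))))); first by [].
by field.
Qed.

Lemma is_derive_moment q y : 0 < y ->
  is_derive y 1 (moment g q) (- (y / 2) * moment g q.+1 y).
Proof.
move=> y0.
pose f (x s : R) := moment_kernel q x s * g s.
have h0 : 0 < 2^-1 :> R by rewrite invr_gt0.
have M0 : 0 <= M by have /andP[/le_trans] := gM.2 _ ltr01; apply.
pose G s := y * (M * moment_bound q.+1 (y / 2)) * atan_density 1 2^-1 s.
have y2 : 0 < y / 2 by rewrite divr_gt0.
have Iy : `]y / 2, 2 * y[%classic y by rewrite /= in_itv/=; apply/andP; split; lra.
have intf (x : R) : `]y / 2, 2 * y[%classic x -> leb.-integrable `]0, +oo[ (EFin \o f x).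
  rewrite /= in_itv/= => /andP[yx _]; apply: integrable_moment.
  exact: lt_trans yx.
have D0 s : `]0, +oo[%classic s -> 0 < s by rewrite /= in_itv/= andbT.
have df (x s : R) : `]0, +oo[%classic s ->
    is_derive x 1 (f ^~ s) (- (x / 2) * (moment_kernel q.+1 x s * g s)).
  by move=> /D0 s0; apply: is_derive_moment_kernel; rewrite gt_eqF.
have derf (x s : R) : `]y / 2, 2 * y[%classic x -> `]0, +oo[%classic s ->
    derivable (f ^~ s) x 1.
  by move=> _ /(df x)[].
have G0 s : 0 <= G s.
  rewrite mulr_ge0 ?atan_density_ge0 ?(ltW h0)// mulr_ge0 ?(ltW y0)//.
  by rewrite mulr_ge0// moment_bound_ge0.
have intG : leb.-integrable `]0, +oo[ (EFin \o G) by exact: integrable_atan_density.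
have Gub (x s : R) : `]y / 2, 2 * y[%classic x -> `]0, +oo[%classic s ->
    `|partial1of2 f x s| <= G s.
  move=> Ix Ds; have s0 := D0 _ Ds; rewrite partial1of2E.
  have -> := @derive_val _ _ _ _ _ _ _ (df x s Ds).
  move: Ix; rewrite /= in_itv/= => /andP[x1 x2].
  have x0 : 0 <= x / 2 by rewrite divr_ge0// ltW// (lt_trans y2).
  rewrite normrM normrN (ger0_norm x0) /G -(mulrA y).
  apply: ler_pM => //; first by rewrite ler_pdivrMr// mulrC ltW.
  by rewrite mgE// mg_le// ltW.
have mB : measurable (`]0, +oo[%classic : set (measurableTypeR R)) by [].
have d := @derivable_under_integral R _ _ leb f _ mB _ _ _ Iy intf derf _ G0 intG
  Gub.
have e := @differentiation_under_integral R _ _ leb f _ mB _ _ _ Iy intf derf _ G0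
  intG Gub.
apply: DeriveDef; first exact: d.
rewrite -derive1E; apply: etrans e _.
rewrite -RintegralZl//; last exact: integrable_moment.
apply: eq_Rintegral => s; rewrite inE => Ds.
by rewrite partial1of2E; exact: (@derive_val _ _ _ _ _ _ _ (df y s Ds)).
Qed.

End profile.

(** Formal combinations of the functions [y |-> y ^+ a * moment g q y], the
    triple [(c, a, q)] standing for a term with coefficient [c]. *)
Definition moment_comb (l : seq (R * nat * nat)) g y : R :=
  \sum_(m <- l) (m.1.1 * (y ^+ m.1.2 * moment g m.2 y)).

Definition moment_comb_deriv (l : seq (R * nat * nat)) : seq (R * nat * nat) :=
  flatten [seq [:: (m.1.1 * m.1.2%:R, m.1.2.-1, m.2);
                   (- (m.1.1 / 2), m.1.2.+1, m.2.+1)] | m <- l].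

Lemma is_derive_moment_comb M g l y : profile M g -> 0 < y ->
  is_derive y 1 (moment_comb l g) (moment_comb (moment_comb_deriv l) g y).
Proof.
move=> gM y0; elim: l => [|[[c a] q] l IH].
  have E0 x : moment_comb [::] g x = 0 by rewrite /moment_comb big_nil.
  rewrite (_ : moment_comb [::] g = cst 0); last exact/funext.
  exact: is_derive_cst.
have d1 : is_derive y 1 (fun y : R => y ^+ a) (a%:R * y ^+ a.-1).
  by apply: DeriveDef; [exact: exprn_derivable|rewrite exp_derive scaler1].
have d2 := is_derive_moment gM q y0.
have d3 : is_derive y 1 (fun y => c * (y ^+ a * moment g q y)) _ :=
  is_deriveZ c (is_deriveM d1 d2).
have d4 : is_derive y 1 (fun y => c * (y ^+ a * moment g q y) +
  moment_comb l g y) _ := is_deriveD d3 IH.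
rewrite (_ : moment_comb _ g = (fun y => c * (y ^+ a * moment g q y) +
  moment_comb l g y)); last by apply/funext => x; rewrite /moment_comb big_cons.
apply: is_derive_eq d4 _.
rewrite {2}/moment_comb /moment_comb_deriv/= !big_cons/= addrA -/(moment_comb_deriv l).
rewrite -/(moment_comb (moment_comb_deriv l) g y); congr (_ + _).
rewrite exprS.
transitivity (c * (y ^+ a * (- (y / 2) * moment g q.+1 y) +
  moment g q y * (a%:R * y ^+ a.-1))); first by [].
by field.
Qed.

(** One bound for all profiles: constants obtained from it do not depend on the
    point of space-time at which the Poisson integral is taken. *)
Lemma moment_comb1_bounded M l :
  exists B : R, forall g, profile M g -> `|moment_comb l g 1| <= B.
Proof.
elim: l => [|[[c a] q] l [B HB]].
  by exists 0 => g _; rewrite /moment_comb big_nil normr0.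
exists (`|c| * (M * moment_bound q 1 * (pi / 2)) + B) => g gM.
rewrite /moment_comb big_cons/= (le_trans (ler_normD _ _))// lerD ?HB//.
by rewrite expr1n mul1r normrM ler_wpM2l// (moment_le gM).
Qed.

Lemma derive1n_moment_comb M g l (h : R -> R) k : profile M g ->
  (forall y, 0 < y -> h y = moment_comb l g y) ->
  forall y, 0 < y -> derive1n k h y = moment_comb (iter k moment_comb_deriv l) g y.
Proof.
move=> gM hE; elim: k => [|k IH] y y0; first by rewrite derive1n0 hE.
rewrite derive1nS derive1E iterS.
rewrite (@near_eq_derive _ _ _ _ (moment_comb (iter k moment_comb_deriv l) g)).
  exact: (@derive_val _ _ _ _ _ _ _ (is_derive_moment_comb _ gM y0)).
by near=> x; apply: IH; near: x; exact: lt_nbhsr.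
Unshelve. all: end_near. Qed.

End poisson_moments.

(** * From derivative bounds to Hoelder bounds *)

Section hoelder_descent.
Context {R : realType}.
Implicit Types (u du : R -> R) (a b c x y C : R).

(** The derivative of [C / b * y `^ b] dominates that of [u] and of [- u],
    whatever the sign of [b]. *)
Lemma increment_le u du b c C : b != 0 ->
  (forall y : R, 0 < y -> y <= c -> is_derive y 1 u (du y)) ->
  (forall y, 0 < y -> y <= c -> `|du y| <= C * y `^ (b - 1)) ->
  forall x y, 0 < x -> x < y -> y <= c ->
  `|u y - u x| <= C / b * (y `^ b - x `^ b).
Proof.
move=> b0 dU bU x y x0 xy yc.
have main (e : R) : `|e| = 1 -> e * (u y - u x) <= C / b * (y `^ b - x `^ b).
  move=> e1; pose f t := C / b * t `^ b - e * u t.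
  have df (t : R) : t \in `[x, y] -> is_derive t 1 f (C * t `^ (b - 1) - e * du t).
    rewrite in_itv/= => /andP[xt ty]; have t0 := lt_le_trans x0 xt.
    have d1 : is_derive t 1 (fun t : R => C / b * t `^ b)
      (C / b * (b * t `^ (b - 1))) := is_deriveZ (C / b) (is_derive1_powR b t0).
    have d2 : is_derive t 1 (fun t : R => e * u t) (e * du t) :=
      is_deriveZ e (dU t t0 (le_trans ty yc)).
    have d3 : is_derive t 1 f _ := is_deriveB d1 d2.
    by apply: is_derive_eq d3 _; rewrite mulrA divfK.
  pose f' t := C * t `^ (b - 1) - e * du t.
  have dfo (t : R) : t \in `]x, y[ -> is_derive t 1 f (f' t).
    by move=> tI; apply: df; exact: subset_itv_oo_cc tI.
  have cf : {within `[x, y], continuous f}.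
    by apply: derivable_within_continuous => t tI; have [] := df t tI.
  have [z zxy fE] := MVT xy dfo cf.
  have zx : x < z < y by move: zxy; rewrite in_itv.
  have z0 : 0 < z by case/andP: zx => /(lt_trans x0).
  have zc : z <= c by case/andP: zx => _ /ltW/le_trans; apply.
  have : 0 <= C * z `^ (b - 1) - e * du z.
    rewrite subr_ge0 (le_trans _ (bU z z0 zc))//.
    by rewrite (le_trans (ler_norm _))// normrM e1 mul1r.
  move=> h; have : 0 <= f y - f x by rewrite fE mulr_ge0// subr_ge0 ltW.
  by rewrite /f; lra.
rewrite ler_norml; apply/andP; split.
  have := main (-1); rewrite normrN normr1 => /(_ erefl); lra.
by have := main 1; rewrite normr1 => /(_ erefl); lra.
Qed.

Context {G : Type} (U : nat -> G -> R -> R) (S : set G).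
Hypothesis dU : forall j g y, S g -> 0 < y -> is_derive y 1 (U j g) (U j.+1 g y).
Hypothesis U1 : forall j, exists B, forall g, S g -> `|U j g 1| <= B.

(** Integrating from [1] towards [0] gains one power of [y] at each order. As
    [a < m <= k], the exponents stay negative: no logarithm appears, and the
    values at [1] are absorbed. *)
Lemma derivative_descent (m k : nat) a (P : set G) : P `<=` S -> (m <= k)%N ->
  a < m%:R ->
  (exists C, forall g y, P g -> 0 < y -> y <= 1 ->
     `|U k g y| <= C * y `^ (a - k%:R)) ->
  exists C, forall g y, P g -> 0 < y -> y <= 1 ->
     `|U m g y| <= C * y `^ (a - m%:R).
Proof.
move=> PS mk am; elim: k mk => [|k IH].
  by rewrite leqn0 => /eqP ->.
rewrite leq_eqVlt => /predU1P[->//|]; rewrite ltnS => mk [C HC].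
apply: IH => //.
have [B HB] := U1 k.
have ak : a < k%:R by rewrite (lt_le_trans am)// ler_nat.
have b0 : a - k%:R < 0 by rewrite subr_lt0.
exists (`|B| + C / (k%:R - a)) => g y Pg y0 y1.
have Sg := PS _ Pg.
have C0 : 0 <= C.
  by have := HC g 1 Pg ltr01 (lexx _); rewrite powR1 mulr1; exact: le_trans.
have yb1 : 1 <= y `^ (a - k%:R).
  by rewrite -[leLHS](powRr0 y) ger_powR ?y0// ltW.
have Ck : 0 <= C / (k%:R - a) by rewrite divr_ge0// subr_ge0 ltW.
have H1 := HB g Sg.
have B1 : `|U k g 1| <= `|B| by rewrite (le_trans H1)// ler_norm.
move: y1; rewrite le_eqVlt => /predU1P[->|y1].
  by rewrite powR1 mulr1 (le_trans B1)// lerDl.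
have Hb (t : R) : 0 < t -> t <= 1 -> `|U k.+1 g t| <= C * t `^ (a - k%:R - 1).
  move=> t0 t1; have := HC g t Pg t0 t1.
  by rewrite -natr1 (_ : a - k%:R - 1 = a - (k%:R + 1))//; ring.
have H2 := @increment_le (U k g) (U k.+1 g) (a - k%:R) 1 C (ltr0_neq0 b0)
  (fun t t0 _ => dU k Sg t0) Hb y 1 y0 y1 (lexx _).
rewrite powR1 in H2.
have : `|U k g y| <= `|U k g 1| + `|U k g 1 - U k g y|.
  rewrite -lerBlDl; rewrite (distrC (U k g 1)).
  exact: lerB_dist.
have e2 : C / (a - k%:R) * (1 - y `^ (a - k%:R)) =
    C / (k%:R - a) * (y `^ (a - k%:R) - 1).
  move: (y `^ _) => Y; field.
  by rewrite !subr_eq0 ?(lt_eqF ak) ?(gt_eqF ak).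
rewrite {}e2 in H2.
move: (y `^ _) yb1 H2 => Y Y1 H2 H3.
have : `|B| <= `|B| * Y by rewrite ler_peMr.
nra.
Qed.

(** [h] or minus its second difference with the value at [0] left out: up to
    sign, the integrand of the fractional power at a zero of the function. *)
Definition defect (m : nat) (h : R -> R) y : R :=
  if m == 1%N then h y else 2 * h y - h (2 * y).

(** For [m = 1] the first derivative is integrated once. For [m = 2] the bound
    on the second derivative first controls the increment of [U 1 g] between [y]
    and [2 * y], that is, up to a factor [- 2], the derivative of the
    defect. *)
Lemma defect_hoelder (m k : nat) a (P : set G) : P `<=` S ->
  (1 <= m <= 2)%N -> (m <= k)%N -> m.-1%:R < a -> a < m%:R ->
  (exists C, forall g y, P g -> 0 < y -> y <= 1 ->
     `|U k g y| <= C * y `^ (a - k%:R)) ->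
  exists2 C, 0 <= C & forall g x y, P g -> 0 < x -> x < y -> y <= 2^-1 ->
     defect m (U 0 g) y <= defect m (U 0 g) x + C * y `^ a.
Proof.
move=> PS m12 mk ma am HC.
have [C {}HC] := derivative_descent PS mk am HC.
have a0 : 0 < a by rewrite (le_lt_trans _ ma).
have [[g0 Pg0]|noP] := pselect (exists g, P g); last first.
  by exists 0 => // g x y Pg; exfalso; apply: noP; exists g.
have C0 : 0 <= C.
  by have := HC g0 1 Pg0 ltr01 (lexx _); rewrite powR1 mulr1; exact: le_trans.
have conclude (psi dpsi : R -> R) D x y : 0 <= D ->
    (forall y : R, 0 < y -> y <= 2^-1 -> is_derive y 1 psi (dpsi y)) ->
    (forall y, 0 < y -> y <= 2^-1 -> `|dpsi y| <= D * y `^ (a - 1)) ->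
    0 < x -> x < y -> y <= 2^-1 -> psi y <= psi x + D / a * y `^ a.
  move=> D0 dpsi1 dpsi2 x0 xy yc.
  have := increment_le (lt0r_neq0 a0) dpsi1 dpsi2 x0 xy yc.
  move=> /(le_trans (ler_norm _)); rewrite lerBlDl => /le_trans; apply.
  by rewrite lerD2l ler_wpM2l ?divr_ge0 ?(ltW a0)// gerBl powR_ge0.
have h1 (y : R) : y <= 2^-1 -> y <= 1 by move=> yh; rewrite (le_trans yh)// invf_le1// ler1n.
case: m m12 mk ma am HC => [|[|[|//]]]// _ mk ma am HC.
  exists (C / a); first by rewrite divr_ge0// ltW.
  move=> g x y Pg x0 xy yc; rewrite /defect/=.
  apply: (conclude _ (U 1 g)) => // t t0 tc; first exact: dU (PS _ Pg) t0.
  exact: HC Pg t0 (h1 _ tc).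
pose D := 2 * (C / (a - 1) * 2 `^ (a - 1)).
have a1 : 0 < a - 1 by rewrite subr_gt0.
have D0 : 0 <= D by rewrite !mulr_ge0 ?invr_ge0 ?(ltW a1)// powR_ge0.
exists (D / a); first by rewrite divr_ge0// ltW.
move=> g x y Pg x0 xy yc; rewrite /defect/=; have Sg := PS _ Pg.
apply: (conclude (fun y => 2 * U 0 g y - U 0 g (2 * y))
  (fun y => 2 * U 1 g y - U 1 g (2 * y) * 2)) => // t t0 tc.
  have t20 : 0 < 2 * t by rewrite mulr_gt0.
  have d1 : is_derive t 1 (fun t : R => 2 * t) (2 * 1) := is_deriveZ 2 (is_derive_id t 1).
  have d2 : is_derive t 1 (fun y => U 0 g (2 * y)) _ :=
    @is_derive1_comp _ (U 0 g) (fun t => 2 * t) t _ _ (dU 0 Sg t20) d1.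
  have d3 : is_derive t 1 (fun y => 2 * U 0 g y) (2 * U 1 g t) := is_deriveZ 2 (dU 0 Sg t0).
  have := is_deriveB d3 d2; rewrite mulr1; apply.
have t2 : t < 2 * t by lra.
have t21 : 2 * t <= 1 by lra.
have Hb (r : R) : 0 < r -> r <= 1 -> `|U 2 g r| <= C * r `^ (a - 1 - 1).
  move=> r0 r1; have := HC g r Pg r0 r1.
  by rewrite (_ : a - 1 - 1 = a - 2)//; ring.
have H2 := @increment_le (U 1 g) (U 2 g) (a - 1) 1 C (lt0r_neq0 a1)
  (fun t t0 _ => dU 1 Sg t0) Hb t (2 * t) t0 t2 t21.
rewrite (_ : _ - _ = - (2 * (U 1 g (2 * t) - U 1 g t))); last by ring.
rewrite normrN normrM ger0_norm// /D -!mulrA ler_wpM2l// mulrA.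
rewrite (le_trans H2)// ler_wpM2l ?divr_ge0 ?(ltW a1)//.
by rewrite powRM ?(ltW t0)// gerBl powR_ge0.
Qed.

End hoelder_descent.

(** * Behaviour in space-time: small times and lower semicontinuity *)

Section limits.
Context {R : realType} (n : nat).
Notation leb := (@lebesgue_measure R).
Notation ST := (R * 'rV[R]_n)%type.
Implicit Types (F : ST -> R) (p : ST).

Lemma continuous_box F p (e : R) : {for p, continuous F} -> 0 < e ->
  exists2 d : R, 0 < d & forall t z, `|t - p.1| < d -> rV_box p.2 d z ->
    `|F (t, z) - F p| < e.
Proof.
move=> /cvgrPdist_lt cF e0; have /nbhs_ballP[d /= d0 dF] := cF e e0.
exists d => // t z td zd; rewrite distrC; apply: dF; split => /=.
  by rewrite /ball/= distrC.
split => // i j; rewrite [i]ord1 /ball/= distrC; exact: zd.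
Qed.

(** Upper half of the approximate identity property; the error is linear in the
    time [s] because the Gaussian tail is bounded by a multiple of [tanh s]. *)
Lemma heat_le_near M F p (e : R) : bounded_nonneg M F ->
  {for p, continuous F} -> 0 < e ->
  exists2 B : R, 0 <= B & forall s, 0 < s -> heat F p s <= F p + e + B * s.
Proof.
move=> HF cF e0; have [d d0 dF] := continuous_box cF e0.
have F0 q : 0 <= F q by have /andP[] := HF.2 q.
have FM q : F q <= M by have /andP[] := HF.2 q.
have M0 : 0 <= M by rewrite (le_trans (F0 p)).
(* Half of the Gaussian exponent gives the decay away from [p.2], through
   [expR (- x) <= x^-1] and [tanh s <= 2 * s]; the other half, that is
   [lambda = 2^-1], is integrated. *)
pose B1 := M * (16 / d ^+ 2) * (2^-1)^-1 `^ (n%:R / 2).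
have B10 : 0 <= B1 by rewrite !mulr_ge0 ?powR_ge0// invr_ge0 exprn_ge0// ltW.
have B20 : 0 <= M / d by rewrite divr_ge0// ltW.
exists (B1 + M / d) => [|s s0]; first by rewrite addr_ge0.
have Fe0 : 0 <= F p + e by rewrite addr_ge0// ltW.
have [ds|sd] := leP d s.
  rewrite (le_trans (heat_le HF p s0))// mulrDl addrA -[leLHS]add0r lerD//.
    by rewrite addr_ge0// mulr_ge0// ltW.
  by rewrite mulrAC ler_pdivlMr// ler_wpM2l.
pose G (l : R) (z : 'rV[R]_n) :=
  expR (- (l * coth s / 2 / 2 * \sum_i (z ord0 i - p.2 ord0 i) ^+ 2)) /
  (2 * pi * sinh (2 * s)) `^ (n%:R / 2).
have G0 l z : 0 <= G l z by rewrite divr_ge0 ?expR_ge0 ?powR_ge0.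
have mG l : measurable_fun [set: 'rV[R]_n] (G l).
  apply: measurable_funM => //; apply: measurableT_comp => //.
  apply: measurableT_comp => //; apply: measurable_funM => //.
  apply: measurable_rV_sum => i; apply: measurable_funX.
  by apply: measurable_funB => //; exact: measurable_rV_coord.
have N0 := mehler_normalizer_gt0 s0.
have c0 := coth_gt0 s0.
have t0 : tanh s = (coth s)^-1 by rewrite /tanh /coth (invf_div (cosh s)).
pose k := M * (16 * s / d ^+ 2).
have k0 : 0 <= k.
  apply: mulr_ge0 => //; apply: divr_ge0; last by rewrite exprn_ge0// ltW.
  by rewrite mulr_ge0// ltW.
have KG z : mehler_kernel s p.2 z <= G 1 z.
  rewrite (le_trans (mehler_kernel_le _ _ s0))// /G.
  by rewrite (_ : 1 * coth s / 2 / 2 = coth s / 4)//; field.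
have far z : ~ rV_box p.2 d z -> mehler_kernel s p.2 z <= 16 * s / d ^+ 2 * G 2^-1 z.
  move=> /existsNP[i /negP]; rewrite -leNgt => zi.
  rewrite (le_trans (mehler_kernel_le _ _ s0))// /G [leRHS]mulrA ler_pM2r; last first.
    by rewrite invr_gt0 powR_gt0.
  set Q := \sum_i _.
  have dQ : d ^+ 2 <= Q.
    rewrite /Q (bigD1 i)//= -[leLHS]addr0 lerD//; last first.
      by apply: sumr_ge0 => j _; exact: sqr_ge0.
    by rewrite -[leRHS]real_normK ?num_real// ler_sqr ?nnegrE// ltW.
  rewrite (_ : coth s / 4 * Q = coth s / 8 * Q + 2^-1 * coth s / 2 / 2 * Q);
    last by field.
  rewrite opprD expRD ler_pM2r ?expR_gt0//.
  have x0 : 0 < coth s / 8 * d ^+ 2 by apply: mulr_gt0; [exact: divr_gt0|exact: exprn_gt0].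
  apply: (@le_trans _ _ (coth s / 8 * d ^+ 2)^-1).
    rewrite expRN lef_pV2 ?posrE ?expR_gt0//.
    rewrite (@le_trans _ _ (1 + coth s / 8 * Q))//; last exact: expR_ge1Dx.
    rewrite -[leLHS]add0r lerD//; apply: ler_wpM2l => //.
    by rewrite divr_ge0// ltW.
  rewrite (_ : _^-1 = tanh s * (8 / d ^+ 2)); last first.
    by rewrite t0; field; rewrite !gt_eqF.
  rewrite (_ : 16 * s / _ = 2 * s * (8 / d ^+ 2)); last by field; rewrite gt_eqF.
  apply: ler_wpM2r; last exact: tanh_le.
  by rewrite divr_ge0// exprn_ge0// ltW.
have main z : mehler_kernel s p.2 z * F (p.1 - s, z) <=
    (F p + e) * G 1 z + k * G 2^-1 z.
  have K0 := mehler_kernel_ge0 s p.2 z.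
  have [zb|zb] := pselect (rV_box p.2 d z).
    rewrite -[leLHS]addr0; apply: lerD; last exact: mulr_ge0.
    rewrite mulrC; apply: ler_pM => //.
    have : `|F (p.1 - s, z) - F p| < e.
      by apply: dF => //; rewrite addrAC subrr sub0r normrN gtr0_norm.
    by rewrite ltr_norml => /andP[_]; lra.
  rewrite -[leLHS]add0r; apply: lerD; first exact: mulr_ge0.
  rewrite mulrC /k -mulrA; apply: ler_pM => //; exact: far.
rewrite -lee_fin (heatE HF)//.
apply: (@le_trans _ _ (\int[lebesgue_rV]_z
    ((F p + e)%:E * (G 1 z)%:E + k%:E * (G 2^-1 z)%:E))%E).
  apply: ge0_le_integral => //.
  - by move=> z _; rewrite lee_fin mulr_ge0// mehler_kernel_ge0.
  - by apply/measurable_EFinP; exact: (measurable_heat_section HF).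
  - by apply: emeasurable_funD; apply/measurable_EFinP; exact: measurable_funM.
  - by move=> z _; rewrite -!EFinM -EFinD lee_fin.
rewrite ge0_integralD//; last 4 first.
- by move=> z _; rewrite mule_ge0 ?lee_fin.
- by apply/measurable_EFinP; exact: measurable_funM.
- by move=> z _; rewrite mule_ge0 ?lee_fin.
- by apply/measurable_EFinP; exact: measurable_funM.
rewrite !ge0_integralZl ?lee_fin//; last 4 first.
- exact/measurable_EFinP.
- by move=> z _; rewrite lee_fin.
- exact/measurable_EFinP.
- by move=> z _; rewrite lee_fin.
have h0 : 0 < 2^-1 :> R by rewrite invr_gt0.
have I1 := @integral_mehler_gauss_le _ n s 1 p.2 s0 ltr01.
have I2 := @integral_mehler_gauss_le _ n s 2^-1 p.2 s0 h0.
rewrite invr1 powR1 in I1.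
have Fe0' : (0 <= (F p + e)%:E)%E by rewrite lee_fin.
have k0' : (0 <= k%:E)%E by rewrite lee_fin.
apply: le_trans (leeD (lee_wpmul2l Fe0' I1) (lee_wpmul2l k0' I2)) _.
rewrite -!EFinM -EFinD lee_fin mulr1 lerD2l mulrDl.
rewrite (_ : k * _ = B1 * s); last by rewrite /k /B1; ring.
by rewrite lerDl mulr_ge0// ltW.
Qed.

(** The factor [sqrt pi] comes from [stable_mass_le]; it is harmless because the
    estimate is used where [F p] is close to [0]. *)
Lemma poisson_le_near M F p (e : R) : bounded_nonneg M F ->
  {for p, continuous F} -> 0 < e ->
  exists2 y0 : R, 0 < y0 & forall y, 0 < y -> y < y0 ->
    poisson y F p <= Num.sqrt pi * F p + e.
Proof.
move=> HF cF e0.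
have spi0 : 0 < Num.sqrt pi :> R by rewrite sqrtr_gt0 pi_gt0.
have F0 q : 0 <= F q by have /andP[] := HF.2 q.
have M0 : 0 <= M by have /andP[/le_trans] := HF.2 p; apply.
have e20 : 0 < e / (2 * Num.sqrt pi) by rewrite divr_gt0// mulr_gt0.
have [B B0 HB] := heat_le_near HF cF e20.
set e1 := e / _ in e20 HB.
have BM : 0 <= B + M by rewrite addr_ge0.
pose D := (B + M) / Num.sqrt pi.
have D0 : 0 <= D by rewrite divr_ge0// ltW.
have D1 : 0 < D * (pi / 2) + 1 by rewrite ltr_wpDl// mulr_ge0// divr_ge0// pi_ge0.
exists (e / 2 / (D * (pi / 2) + 1)) => [|y y0 yy0]; first by rewrite !divr_gt0.
have h0 : 0 < 2^-1 :> R by rewrite invr_gt0.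
have Fe0 : 0 <= F p + e1 by rewrite addr_ge0// ltW.
rewrite -lee_fin (poissonEFin HF)//.
have mst : measurable_fun (`]0, +oo[%classic : set (measurableTypeR R)) (EFin \o stable y).
  by apply/measurable_EFinP/measurable_funTS; exact: measurable_stable.
have mat : measurable_fun (`]0, +oo[%classic : set (measurableTypeR R)) (EFin \o @atan_density R 1 2^-1).
  by apply/measurable_EFinP/measurable_funTS; exact: measurable_atan_density.
apply: (@le_trans _ _ (\int[leb]_(s in `]0%R, +oo[) ((F p + e1)%:E *
    (stable y s)%:E + (y * D)%:E * (atan_density 1 2^-1 s)%:E))%E).
  apply: ge0_le_integral => //.
  - move=> s _; rewrite lee_fin mulr_ge0 ?(heat_ge0 HF)//.
    by rewrite stable_ge0// ltW.
  - by apply/measurable_EFinP/measurable_funTS; exact: (measurable_stable_heat HF).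
  - by apply: emeasurable_funD; apply: emeasurable_funM.
  move=> s; rewrite /= in_itv/= andbT => s0.
  rewrite -!EFinM -EFinD lee_fin.
  have hM := heat_le HF p s0; have hB := HB s s0.
  rewrite -lerBlDl (mulrC (F p + e1)) -mulrBr.
  set w := heat F p s - _.
  have wB : w <= B * s by rewrite /w lerBlDl.
  have wM : w <= M by rewrite (le_trans _ hM)// gerBl.
  have w2 : w * (1 + s) <= (B + M) * s by nra.
  have [w0|w0] := leP w 0.
    rewrite (@le_trans _ _ 0)//.
      by rewrite mulr_ge0_le0// stable_ge0// ltW.
    rewrite mulr_ge0 ?atan_density_ge0 ?(ltW h0)//.
    by rewrite mulr_ge0// ltW.
  rewrite /stable /atan_density.
  have r0 : 0 < Num.sqrt s by rewrite sqrtr_gt0.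
  rewrite powR32 ?(ltW s0)// powR12_sqrt ?(ltW s0)//.
  rewrite (_ : 2^-1 - 1 = - 2^-1 :> R); last by field.
  rewrite powRN powR12_sqrt ?(ltW s0)// !mul1r sqr_sqrtr ?(ltW s0)//.
  set r := Num.sqrt s in r0 *.
  have ex : expR (- (y ^+ 2 / (4 * s))) <= 1.
    by rewrite expR_le1 oppr_le0 divr_ge0 ?sqr_ge0// mulr_ge0// ltW.
  apply: (@le_trans _ _ (y / (2 * Num.sqrt pi) * (1 / (s * r)) * w)).
    apply: ler_wpM2r; first exact: ltW.
    apply: ler_wpM2l; first by rewrite divr_ge0 ?mulr_ge0 ?(ltW y0)// ltW.
    by apply: ler_wpM2r; rewrite // invr_ge0 mulr_ge0// ltW.
  rewrite (_ : _ * w = y / (2 * Num.sqrt pi) / (s * r * (1 + s)) * (w * (1 + s)));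
    last by field; rewrite !gt_eqF// addr_gt0.
  rewrite (_ : y * D * _ =
    y / (2 * Num.sqrt pi) / (s * r * (1 + s)) * ((B + M) * s)); last first.
    by rewrite /D; field; rewrite !gt_eqF// addr_gt0.
  apply: ler_wpM2l => //.
  have s1 : 0 < 1 + s by rewrite addr_gt0.
  by rewrite ltW// !divr_gt0// !mulr_gt0.
rewrite ge0_integralD//; last 4 first.
- by move=> s _; rewrite mule_ge0 ?lee_fin// stable_ge0// ltW.
- by apply: emeasurable_funM.
- move=> s _; rewrite mule_ge0 ?lee_fin ?atan_density_ge0 ?(ltW h0)//.
  by rewrite mulr_ge0// ltW.
- by apply: emeasurable_funM.
rewrite !ge0_integralZl ?lee_fin ?mulr_ge0 ?(ltW y0)//; last 2 first.
- by move=> s _; rewrite lee_fin atan_density_ge0// ltW.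
- by move=> s _; rewrite lee_fin stable_ge0// ltW.
rewrite (integral_atan_density ltr01 h0).
have Fe0' : (0 <= (F p + e1)%:E)%E by rewrite lee_fin.
apply: le_trans (leeD (lee_wpmul2l Fe0' (stable_mass_le y0)) (lexx _)) _.
rewrite -!EFinM -EFinD lee_fin mulrDl (mulrC (F p)) -addrA lerD2l.
rewrite (_ : e1 * _ = e / 2); last by rewrite /e1; field; rewrite gt_eqF.
rewrite [leRHS](splitr e) lerD2l -mulrA.
move: yy0; rewrite ltr_pdivlMr// => /ltW; apply: le_trans.
by rewrite ler_pM2l// lerDl.
Qed.

End limits.

Section fatou.
Context {R : realType} (n : nat).
Notation leb := (@lebesgue_measure R).
Notation ST := (R * 'rV[R]_n)%type.
Implicit Types (F : ST -> R) (p : ST).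

(** Boxes have positive measure, hence a property that holds almost everywhere
    holds at points of the strict past arbitrarily close to a given one. *)
Lemma ae_past_dense (P : ST -> Prop) p (e : R) :
  {ae (@spacetime_measure R n), forall q, P q} -> 0 < e ->
  exists q, [/\ P q, p.1 - e < q.1, q.1 < p.1 & rV_box p.2 e q.2].
Proof.
move=> [N [mN N0 PN]] e0; apply: contrapT => noq.
pose A : set ST := `]p.1 - e, p.1[%classic `*` rV_box p.2 e.
have AN : A `<=` N.
  move=> q [/=]; rewrite in_itv/= => /andP[q1 q2] qb; apply: PN => Pq.
  by apply: noq; exists q; split.
have mA : measurable A by apply: measurableX => //; exact: measurable_rV_box.
have : (spacetime_measure R n A <= spacetime_measure R n N)%E.
  by apply: le_measure => //; rewrite inE.
rewrite [X in (_ <= X)%E]N0 leNgt => /negP; apply.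
rewrite /A [X in (_ < X)%E]product_measure1E//; last exact: measurable_rV_box.
apply: mule_gt0; last exact: lebesgue_rV_box_gt0.
rewrite /= lebesgue_measure_itv/= lte_fin.
have -> : p.1 - e < p.1 by lra.
by rewrite -EFinD lte_fin; lra.
Qed.

(** As a single integral over time and space, to which Fatou's lemma applies
    directly. *)
Lemma integral_weight_heat M F p (w : R -> R) : bounded_nonneg M F ->
  measurable_fun [set: R] w -> (forall s, 0 < s -> 0 <= w s) ->
  (\int[leb]_(s in `]0%R, +oo[) (w s * heat F p s)%:E =
   \int[leb \x @lebesgue_rV R n]_q ((w \_ `]0%R, +oo[) q.1 *
     (mehler_kernel q.1 p.2 q.2 * F (p.1 - q.1, q.2)))%:E)%E.
Proof.
move=> HF mw w0.
have F0 q : 0 <= F q by have /andP[] := HF.2 q.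
have w00 s : 0 <= (w \_ `]0%R, +oo[) s.
  by apply: restrict_ge0 => r; rewrite /= in_itv/= andbT; exact: w0.
have mw0 : measurable_fun [set: R] (w \_ `]0%R, +oo[).
  by apply/(measurable_restrictT _ _).1 => //; exact: measurable_funTS.
have mq : measurable_fun [set: R * 'rV[R]_n] (fun q => ((p, q.1), q.2) : (ST * R) * 'rV[R]_n).
  by apply: measurable_fun_pair => //; exact: measurable_fun_pair.
have mKF : measurable_fun [set: R * 'rV[R]_n]
    (fun q => mehler_kernel q.1 p.2 q.2 * F (p.1 - q.1, q.2)).
  exact: (measurableT_comp (measurable_heat_integrand HF) mq).
have mw1 : measurable_fun [set: R * 'rV[R]_n] (fun q => (w \_ `]0%R, +oo[) q.1).
  exact: (measurableT_comp mw0 measurable_fst).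
rewrite fubini_tonelli1//; last 2 first.
- by apply/measurable_EFinP; exact: (measurable_funM mw1 mKF).
- by move=> q; rewrite lee_fin mulr_ge0// mulr_ge0// mehler_kernel_ge0.
rewrite integral_mkcond; apply: eq_integral => s _; rewrite /fubini_F/= !patchE.
case: ifPn => [|_]; last by rewrite integral0_eq// => z _; rewrite mul0r.
rewrite inE/= in_itv/= andbT => s0; rewrite EFinM (heatE HF)//.
rewrite -ge0_integralZl ?lee_fin ?w0//.
- by apply/measurable_EFinP; exact: (measurable_heat_section HF).
- by move=> z _; rewrite lee_fin mulr_ge0// mehler_kernel_ge0.
Qed.

Lemma cvg_mehler_kernel (x_ : nat -> 'rV[R]_n) (x z : 'rV[R]_n) s :
  (forall i, x_ k ord0 i @[k --> \oo] --> x ord0 i) ->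
  mehler_kernel s (x_ k) z @[k --> \oo] --> mehler_kernel s x z.
Proof.
move=> xx; rewrite mehler_kernelE; under eq_fun do rewrite mehler_kernelE.
apply: cvgM; last exact: cvg_cst.
apply: continuous_cvg; first exact: continuous_expR.
apply: cvg_big => [|i _]; [exact: add_continuous|]; rewrite /mehler_exponent; apply: cvgN.
have sq (e : R) : (x_ k ord0 i + e * z ord0 i) ^+ 2 @[k --> \oo] -->
    (x ord0 i + e * z ord0 i) ^+ 2.
  by apply: cvgM; apply: cvgD => //; exact: cvg_cst.
have sqN := sq (-1); have sqP := sq 1.
rewrite mulN1r in sqN; rewrite mul1r in sqP.
by apply: cvgD; apply: cvgM; try exact: cvg_cst; apply: cvgM => //;
  exact: cvg_cst.
Qed.

(** Lower semicontinuity in the point of space-time: the integrands are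
    nonnegative and depend continuously on it. *)
Lemma fatou_heat M F p (w : R -> R) (p_ : nat -> ST) (c_ : nat -> R) (c : R) :
  bounded_nonneg M F -> continuous F ->
  measurable_fun [set: R] w -> (forall s, 0 < s -> 0 <= w s) ->
  (forall d : R, 0 < d -> \forall k \near \oo,
     `|(p_ k).1 - p.1| < d /\ rV_box p.2 d (p_ k).2) ->
  (forall k, \int[leb]_(s in `]0%R, +oo[) (w s * heat F (p_ k) s)%:E <= (c_ k)%:E)%E ->
  c_ k @[k --> \oo] --> c ->
  (\int[leb]_(s in `]0%R, +oo[) (w s * heat F p s)%:E <= c%:E)%E.
Proof.
move=> HF cF mw w0 pp pc cc.
have F0 q : 0 <= F q by have /andP[] := HF.2 q.
have w00 s : 0 <= (w \_ `]0%R, +oo[) s.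
  by apply: restrict_ge0 => r; rewrite /= in_itv/= andbT; exact: w0.
have mw0 : measurable_fun [set: R] (w \_ `]0%R, +oo[).
  by apply/(measurable_restrictT _ _).1 => //; exact: measurable_funTS.
pose f (p' : ST) (q : R * 'rV[R]_n) : \bar R := ((w \_ `]0%R, +oo[) q.1 *
  (mehler_kernel q.1 p'.2 q.2 * F (p'.1 - q.1, q.2)))%:E.
have IE p' : (\int[leb]_(s in `]0%R, +oo[) (w s * heat F p' s)%:E =
    \int[leb \x @lebesgue_rV R n]_q f p' q)%E.
  exact: (integral_weight_heat p' HF mw w0).
have mf p' : measurable_fun [set: R * 'rV[R]_n] (f p').
  have mq : measurable_fun [set: R * 'rV[R]_n]
      (fun q => ((p', q.1), q.2) : (ST * R) * 'rV[R]_n).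
    by apply: measurable_fun_pair => //; exact: measurable_fun_pair.
  have mKF : measurable_fun [set: R * 'rV[R]_n]
      (fun q => mehler_kernel q.1 p'.2 q.2 * F (p'.1 - q.1, q.2)).
    exact: (measurableT_comp (measurable_heat_integrand HF) mq).
  have mw1 : measurable_fun [set: R * 'rV[R]_n] (fun q => (w \_ `]0%R, +oo[) q.1).
    exact: (measurableT_comp mw0 measurable_fst).
  by apply/measurable_EFinP; exact: (measurable_funM mw1 mKF).
have f0 p' q : (0 <= f p' q)%E.
  by rewrite lee_fin mulr_ge0// mulr_ge0// mehler_kernel_ge0.
have := @fatou _ _ _ (leb \x @lebesgue_rV R n)%E setT measurableT
  (fun k => f (p_ k)) (fun k => mf (p_ k)) (fun k q _ => f0 (p_ k) q).
have xx i : (p_ k).2 ord0 i @[k --> \oo] --> p.2 ord0 i.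
  apply/cvgrPdist_lt => d d0; apply: filterS (pp d d0) => k [_ /(_ i)].
  by rewrite distrC.
have ff q : f (p_ k) q @[k --> \oo] --> f p q.
  apply: cvg_EFin; first exact: nearW.
  apply: cvgM; first exact: cvg_cst.
  apply: cvgM; first exact: cvg_mehler_kernel.
  apply/cvgrPdist_lt => e e0.
  have [d d0 dF] := continuous_box (cF (p.1 - q.1, q.2)) e0.
  apply: filterS (pp d d0) => k [kd _]; rewrite distrC; apply: dF => /=.
    by rewrite opprB addrA subrK.
  by move=> i; rewrite subrr normr0.
under eq_integral do rewrite (cvg_limn_einf_sup (ff _)).1.
rewrite IE => /le_trans; apply.
have cE : (c_ k)%:E @[k --> \oo] --> c%:E by apply: cvg_EFin => //; exact: nearW.
rewrite -(cvg_limn_einf_sup cE).1 !limn_einf_lim.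
apply: lee_lim; [exact: is_cvg_einfs|exact: is_cvg_einfs|].
apply: nearW => k; apply: le_ereal_inf_tmp => _ [j kj <-].
rewrite (le_trans _ (pc j))// IE; apply: ereal_inf_lbound.
by exists j.
Qed.

End fatou.

(** * Integrability against powers *)

Section weights.
Context {R : realType}.
Notation leb := (@lebesgue_measure R).
Implicit Types (phi : R -> R) (a b : R).

Lemma ge0_integral0y_eq0 phi (u v : R) :
  measurable_fun (`]0, +oo[%classic : set (measurableTypeR R)) phi ->
  (forall s, 0 < s -> 0 <= phi s) ->
  (\int[leb]_(s in `]0%R, +oo[) (phi s)%:E = 0)%E ->
  0 <= u -> u < v -> exists2 s, u < s < v & phi s = 0.
Proof.
move=> mphi phi0 int0 u0 uv.
have mE : measurable_fun (`]0, +oo[%classic : set (measurableTypeR R)) (EFin \o phi).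
  exact/measurable_EFinP.
have iabs : (\int[leb]_(s in `]0%R, +oo[) `|(EFin \o phi) s| = 0)%E.
  rewrite -[RHS]int0; apply: eq_integral => s; rewrite inE/= in_itv/= andbT => s0.
  by rewrite ger0_norm// phi0.
have [N [mN N0 subN]] := (ae_eq_integral_abs leb (measurable_itv _) mE).1 iabs.
apply: contrapT => nos.
have sub : `]u, v[%classic `<=` N.
  move=> s; rewrite /= in_itv/= => suv; apply: subN => /= H; apply: nos.
  exists s => //; apply: EFin_inj; apply: H; rewrite in_itv/= andbT.
  by case/andP: suv => /(le_lt_trans u0).
have : (leb `]u, v[%classic <= leb N)%E by apply: le_measure => //; rewrite inE.
rewrite [X in (_ <= X)%E]N0 leNgt => /negP; apply.
by rewrite lebesgue_measure_itv/= lte_fin uv -EFinD lte_fin subr_gt0.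
Qed.

(** A single comparison function serves at both ends: with
    [p = min(b, a - b)], [atan_density] is of order [s `^ (p - 1)] at [0] and
    [s `^ (- p - 1)] at infinity. *)
Lemma integrable_div_powR phi a b (C D : R) : 0 < b -> b < a ->
  measurable_fun (`]0, +oo[%classic : set (measurableTypeR R)) phi ->
  (forall s, 0 < s -> 0 <= phi s) ->
  (forall s, 0 < s -> s <= 2^-1 -> phi s <= C * s `^ a) ->
  (forall s, 0 < s -> phi s <= D) ->
  leb.-integrable `]0, +oo[ (EFin \o (fun s => phi s / s `^ (1 + b))).
Proof.
move=> b0 ba mphi phi0 phiC phiD.
have a0 : 0 < a := lt_trans b0 ba.
pose p := Num.min b (a - b).
have p0 : 0 < p by rewrite lt_min b0 subr_gt0.
have pb : p <= b by rewrite ge_min lexx.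
have pab : p <= a - b by rewrite ge_min lexx orbT.
have D0 : 0 <= D by rewrite (le_trans (phi0 _ ltr01))// phiD.
(* the second term takes care of [s > 2^-1], where [1 <= (2 * s) `^ a] *)
pose K := `|C| + D * 2 `^ a.
have K0 : 0 <= K by rewrite addr_ge0// mulr_ge0// powR_ge0.
have DK : D <= K.
  rewrite /K -[leLHS]add0r lerD// ler_peMr//.
  by rewrite -[leLHS](powRr0 2) ler_powR// ?ler1n// ltW.
have phiK s : 0 < s -> phi s <= K * s `^ a.
  move=> s0; have [sh|hs] := leP s 2^-1.
    rewrite (le_trans (phiC s s0 sh))// ler_wpM2r ?powR_ge0//.
    by rewrite (le_trans (ler_norm C))// lerDl mulr_ge0// powR_ge0.
  rewrite (le_trans (phiD s s0))//.
  rewrite (@le_trans _ _ (D * 2 `^ a * s `^ a))//.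
    rewrite -mulrA ler_peMr// -powRM ?(ltW s0)//.
    rewrite (@le_trans _ _ (1 `^ a))//; first by rewrite powR1.
    apply: ge0_ler_powR; rewrite ?nnegrE ?(ltW a0)//.
      by rewrite mulr_ge0// ltW.
    by rewrite mulrC -ler_pdivrMr// mul1r ltW.
  by rewrite ler_wpM2r ?powR_ge0// lerDr.
apply: (le_integrable _ _ _ (integrable_atan_density (2 * K / p) p0)) => //.
  apply/measurable_EFinP; apply: measurable_funM => //.
  apply: measurable_funV; apply: measurable_funTS; exact: measurable_powR.
move=> s; rewrite /= in_itv/= andbT => s0.
have q0 : 0 <= phi s / s `^ (1 + b) by rewrite divr_ge0 ?powR_ge0 ?phi0.
rewrite lee_fin (ger0_norm q0) (le_trans _ (ler_norm _))//.
rewrite /atan_density !mul1r.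
have sp (r : R) : 0 < s `^ r by rewrite powR_gt0.
have spD r t : s `^ (r + t) = s `^ r * s `^ t.
  by apply: powRD; apply/implyP => _; rewrite gt_eqF.
set S := s `^ p.
have S0 : 0 < S by exact: sp.
have SS0 : 0 < 1 + S ^+ 2 by rewrite addr_gt0// exprn_gt0.
rewrite (_ : 2 * K / p * _ = 2 * K * s `^ (p - 1) / (1 + S ^+ 2)); last first.
  by field; rewrite !gt_eqF.
rewrite ler_pdivlMr// [leLHS]mulrAC ler_pdivrMr//.
have [s1|s1] := leP s 1.
  apply: (@le_trans _ _ (K * s `^ a * 2)).
    rewrite ler_pM ?phi0 ?phiK// ?(ltW SS0)//.
    have S1 : S <= 1.
      by rewrite /S -[leRHS](powRr0 s) ger_powR ?s0// ltW.
    have : S ^+ 2 <= 1 by rewrite expr_le1// ltW.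
    lra.
  rewrite (_ : 2 * K * _ * _ = K * s `^ (p - 1 + (1 + b)) * 2); last first.
    by rewrite (spD (p - 1)); ring.
  rewrite ler_wpM2r// ler_wpM2l// ger_powR ?s0//.
  by lra.
apply: (@le_trans _ _ (K * (2 * S ^+ 2))).
  rewrite ler_pM ?phi0 ?(ltW SS0)//; first by rewrite (le_trans (phiD s s0)).
  have S1 : 1 <= S.
    by rewrite /S -[leLHS](powRr0 s) ler_powR// ltW.
  have : 1 <= S ^+ 2 by rewrite expr_ge1// ltW.
  lra.
rewrite (_ : 2 * K * _ * _ = K * (2 * s `^ (p - 1 + (1 + b)))); last first.
  by rewrite (spD (p - 1)); ring.
rewrite ler_wpM2l// ler_wpM2l// expr2 /S -spD ler_powR ?(ltW s1)//.
by lra.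
Qed.

End weights.

(** * Consequences of the Lipschitz condition *)

Section lambda.
Context {R : realType} (n : nat).
Notation leb := (@lebesgue_measure R).
Notation ST := (R * 'rV[R]_n)%type.
Implicit Types (f F : ST -> R) (p : ST).

Lemma spacetime_measureT_gt0 : (0 < @spacetime_measure R n setT)%E.
Proof.
rewrite lt0e measure_ge0 andbT; apply/eqP => m0.
have aeF : {ae (@spacetime_measure R n), forall q, (fun _ : ST => False) q}.
  by exists setT; split.
by have [q []] := ae_past_dense (0, 0) aeF ltr01.
Qed.

Lemma Lnorm_infty_le (g : ST -> \bar R) (c : \bar R) :
  ('N[@spacetime_measure R n]_+oo [g] <= c)%E ->
  {ae (@spacetime_measure R n), forall q, (`|g q| <= c)%E}.
Proof.
by rewrite unlock spacetime_measureT_gt0 => /ess_supP.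
Qed.

(** For a continuous function an essential bound is a bound. *)
Lemma Lambda_bounded a f : Lambda a f -> continuous f ->
  exists2 M : R, 0 <= M & forall p, `|f p| <= M.
Proof.
move=> [fL _] cf.
have : ('N[@spacetime_measure R n]_+oo [EFin \o f] < +oo)%E.
  by move: fL; rewrite inE/= => /andP[_]; rewrite inE.
set c := ('N[_]_ _ [_])%E => coo.
have c0 : (0 <= c)%E by exact: Lnorm_ge0.
have cfin : c \is a fin_num by rewrite ge0_fin_numE.
have /Lnorm_infty_le aef : (c <= (fine c)%:E)%E by rewrite fineK.
exists (fine c) => [|p]; first exact: fine_ge0.
apply/ler_addgt0Pr => e e0; rewrite leNgt; apply/negP => fp.
have [d d0 df] := continuous_box (cf p) e0.
have [q [qc q1 q2 qb]] := ae_past_dense p aef d0.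
have := df q.1 q.2; rewrite -surjective_pairing => /(_ _ qb) h.
have : `|f q - f p| < e.
  by apply: h; rewrite ltr_distl q1 (lt_trans q2)// ltrDl.
move: qc; rewrite /= lee_fin => qc h2.
have := ler_normB (f q) (f q - f p); rewrite opprB addrC subrK => h3.
have : fine c + e < fine c + e.
  by rewrite (lt_le_trans fp)// (le_trans h3)// lerD// ltW.
by rewrite ltxx.
Qed.

Lemma continuous_max0 F : continuous F -> continuous (fun p => Num.max (F p) 0).
Proof.
move=> cF p; apply: (@continuous_comp _ _ _ F (fun x : R => Num.max x 0)).
  exact: cF.
apply: (@continuous_max _ _ id (cst 0)); first exact: cvg_id.
exact: cst_continuous.
Qed.

End lambda.

(** * The integrand at a zero of the function *)

Section defects.
Context {R : realType} (n : nat).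
Notation leb := (@lebesgue_measure R).
Notation ST := (R * 'rV[R]_n)%type.
Implicit Types (f F : ST -> R) (p : ST) (m k : nat) (y s : R).

Definition defect_weight m (y s : R) : R := defect m (stable ^~ s) y.

(** For [m = 2] the two densities have the same power of [s], and the
    exponential factor of [stable (2 * y)] is the smaller one. *)
Lemma defect_weight_gt0 m (y s : R) : 0 < y -> 0 < s -> 0 < defect_weight m y s.
Proof.
move=> y0 s0; rewrite /defect_weight /defect; case: ifP => _; first exact: stable_gt0.
have spi0 : 0 < Num.sqrt pi :> R by rewrite sqrtr_gt0 pi_gt0.
have S0 : 0 < s `^ (3 / 2) by rewrite powR_gt0.
rewrite /stable (_ : _ - _ = y / Num.sqrt pi / s `^ (3 / 2) *
  (expR (- (y ^+ 2 / (4 * s))) - expR (- ((2 * y) ^+ 2 / (4 * s))))); last first.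
  move: (expR _) (expR _) => e1 e2; move: (s `^ _) S0 => S S0.
  by field; rewrite !gt_eqF.
rewrite mulr_gt0 ?divr_gt0// subr_gt0 ltr_expR ltrN2 ltr_pM2r.
  have : 0 < y ^+ 2 by rewrite exprn_gt0.
  by rewrite exprMn; lra.
by rewrite invr_gt0 mulr_gt0.
Qed.

Lemma measurable_defect_weight m y : measurable_fun [set: R] (defect_weight m y).
Proof.
rewrite /defect_weight /defect; case: (m == 1%N); first exact: measurable_stable.
apply: measurable_funB; last exact: measurable_stable.
by apply: measurable_funM => //; exact: measurable_stable.
Qed.

Section bounded.
Context (M : R) (F : ST -> R) (HF : bounded_nonneg M F).

Lemma profile_heat p : profile M (heat F p).
Proof.
split=> [|s s0]; first exact: (measurable_heat_time HF).
by rewrite (heat_ge0 HF) (heat_le HF).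
Qed.

Lemma poisson_moment p y : 0 < y ->
  poisson y F p = moment_comb [:: ((2 * Num.sqrt pi)^-1, 1%N, 0%N)] (heat F p) y.
Proof.
move=> y0; rewrite (poissonE HF)// /moment_comb big_seq1/= expr1 mulrA.
rewrite -RintegralZl//; last exact: (integrable_moment (profile_heat p)).
apply: eq_Rintegral => s _; rewrite /stable /moment_kernel expr0.
by ring.
Qed.

Lemma defect_poissonE m p y : 0 < y ->
  defect m (fun y => poisson y F p) y =
  \int[leb]_(s in `]0, +oo[) (defect_weight m y s * heat F p s).
Proof.
move=> y0; rewrite /defect_weight /defect; case: (m == 1%N).
  exact: (poissonE HF).
have y20 : 0 < 2 * y by rewrite mulr_gt0.
rewrite !(poissonE HF)// -RintegralZl//; last exact: (integrable_stable_heat HF).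
rewrite -RintegralB//; last 2 first.
- have := integrable_stable_heat HF p y0.
  by move=> /(integrableZl _ 2); apply.
- exact: (integrable_stable_heat HF).
by apply: eq_Rintegral => s _; ring.
Qed.

Lemma integrable_defect m p y : 0 < y -> leb.-integrable `]0, +oo[
  (EFin \o (fun s => defect_weight m y s * heat F p s)).
Proof.
move=> y0; rewrite /defect_weight /defect; case: (m == 1%N).
  exact: (integrable_stable_heat HF).
have y20 : 0 < 2 * y by rewrite mulr_gt0.
have i2 : leb.-integrable `]0, +oo[
    (EFin \o (fun s => 2 * (stable y s * heat F p s))).
  have := integrable_stable_heat HF p y0.
  by move=> /(integrableZl _ 2); apply.
rewrite (_ : _ \o _ = (EFin \o (fun s => 2 * (stable y s * heat F p s))%R) \-
  (EFin \o (fun s => stable (2 * y) s * heat F p s)%R))%E; last first.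
  by apply/funext => s /=; rewrite -EFinB; congr EFin; ring.
by apply: integrableB => //; exact: (integrable_stable_heat HF).
Qed.

Lemma defect_poissonEFin m p y : 0 < y ->
  (defect m (fun y => poisson y F p) y)%:E =
  (\int[leb]_(s in `]0%R, +oo[) (defect_weight m y s * heat F p s)%:E)%E.
Proof.
move=> y0; rewrite defect_poissonE// /Rintegral fineK//.
by apply: integrable_fin_num => //; exact: integrable_defect.
Qed.

Lemma defect_poisson_ge0 m p y : 0 < y -> 0 <= defect m (fun y => poisson y F p) y.
Proof.
move=> y0; rewrite defect_poissonE// /Rintegral fine_ge0// integral_ge0// => s.
rewrite /= in_itv/= andbT => s0.
by rewrite lee_fin mulr_ge0 ?(heat_ge0 HF)// ltW// defect_weight_gt0.
Qed.

Lemma defect_le_double m (h : R -> R) y : 0 <= h y -> 0 <= h (2 * y) ->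
  defect m h y <= 2 * h y.
Proof. by rewrite /defect; case: ifP => _; lra. Qed.

Lemma measurable_defect_poisson m p :
  measurable_fun (`]0, +oo[%classic : set (measurableTypeR R))
    (defect m (fun y => poisson y F p)).
Proof.
have cU y : 0 < y -> {for y, continuous (fun y => poisson y F p)}.
  move=> y0; pose l : seq (R * nat * nat) := [:: ((2 * Num.sqrt pi)^-1, 1%N, 0%N)].
  have d := is_derive_moment_comb l (profile_heat p) y0.
  apply/differentiable_continuous/derivable1_diffP.
  apply: ex_derive; apply: near_eq_is_derive d.
  near=> x; rewrite poisson_moment//; near: x; exact: lt_nbhsr.
apply: open_continuous_measurable_fun; first exact: interval_open.
move=> y; rewrite inE/= in_itv/= andbT => y0.
rewrite /defect; case: (m == 1%N); first exact: cU.
apply: cvgB; first by apply: cvgM; [exact: cvg_cst|exact: cU].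
apply: (@continuous_comp _ _ _ (fun y => 2 * y) (fun y => poisson y F p)).
  by apply: cvgM; [exact: cvg_cst|exact: cvg_id].
by apply: cU; rewrite mulr_gt0.
Unshelve. all: end_near. Qed.

(** Rigidity: the weight and the Mehler kernel are positive, so if the defect
    vanishes at one scale, then at almost every earlier time [F] vanishes almost
    everywhere in space; a positive value would persist on a box. *)
Lemma defect_poisson_eq0 m p y : continuous F -> 0 < y ->
  defect m (fun y => poisson y F p) y = 0 -> forall t x, t <= p.1 -> F (t, x) = 0.
Proof.
move=> cF y0 def0 t x tp.
have F0 q : 0 <= F q by have /andP[] := HF.2 q.
apply/eqP; rewrite eq_le F0 andbT leNgt; apply/negP => Fpos.
have [d d0 dF] := continuous_box (cF (t, x)) Fpos.
have Fd s z : `|s - t| < d -> rV_box x d z -> 0 < F (s, z).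
  by move=> st zx; have := dF s z st zx; rewrite ltr_norml => /andP[]; lra.
have := defect_poissonEFin m p y0; rewrite def0 => /esym int0.
have mphi : measurable_fun (`]0, +oo[%classic : set (measurableTypeR R))
    (fun s => defect_weight m y s * heat F p s).
  apply: measurable_funTS; apply: measurable_funM.
    exact: measurable_defect_weight.
  exact: (measurable_heat_time HF).
have phi0 s : 0 < s -> 0 <= defect_weight m y s * heat F p s.
  by move=> s0; rewrite mulr_ge0 ?(heat_ge0 HF)// ltW// defect_weight_gt0.
have pt0 : 0 <= p.1 - t by rewrite subr_ge0.
have ptd : p.1 - t < p.1 - t + d by rewrite ltrDl.
have [s /andP[s1 s2] /eqP] := ge0_integral0y_eq0 mphi phi0 int0 pt0 ptd.
have s0 : 0 < s by rewrite (le_lt_trans _ s1)// subr_ge0.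
rewrite mulf_eq0 gt_eqF ?defect_weight_gt0//= => /eqP heat0.
have := heatE HF p s0; rewrite heat0 => /esym int1.
have mh : measurable_fun [set: 'rV[R]_n]
    (EFin \o (fun z => mehler_kernel s p.2 z * F (p.1 - s, z))).
  by apply/measurable_EFinP; exact: (measurable_heat_section HF).
have iabs : (\int[lebesgue_rV]_z
    `|(mehler_kernel s p.2 z * F ((p.1 - s)%R, z))%:E| = 0)%E.
  rewrite -[RHS]int1; apply: eq_integral => z _ /=.
  by rewrite ger0_norm// mulr_ge0// mehler_kernel_ge0.
have [N [mN N0 subN]] := (ae_eq_integral_abs _ measurableT mh).1 iabs.
have sub : rV_box x d `<=` N.
  move=> z zx; apply: subN => /= H.
  have : mehler_kernel s p.2 z * F (p.1 - s, z) == 0.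
    by apply/eqP/EFin_inj; exact: H.
  rewrite mulf_eq0 gt_eqF ?mehler_kernel_gt0//=.
  rewrite gt_eqF// Fd// ltr_norml; apply/andP; split; lra.
have := lebesgue_rV_box_gt0 x d0; rewrite lt_neqAle => /andP[/eqP + _]; apply.
apply/esym/eqP; rewrite eq_le measure_ge0 andbT -[leRHS]N0.
by apply: le_measure => //; rewrite inE//; exact: measurable_rV_box.
Qed.

End bounded.
End defects.

(** * Decay of the integrand at small scales *)

Section regularity.
Context {R : realType} (n : nat).
Notation leb := (@lebesgue_measure R).
Notation ST := (R * 'rV[R]_n)%type.
Implicit Types (f F : ST -> R) (p : ST) (m k : nat) (y s : R).

Let l0 : seq (R * nat * nat) := [:: ((2 * Num.sqrt pi)^-1, 1%N, 0%N)].

(** The hypothesis bounds the derivative for each [y] at almost every point;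
    by continuity in [y] it is enough to use the countably many rational [y]. *)
Lemma Lambda_derivative_bound M F f (t0 al : R) k : bounded_nonneg M F ->
  (forall t x, t <= t0 -> f (t, x) = F (t, x)) ->
  (exists C : R, forall y, 0 < y ->
    ('N[@spacetime_measure R n]_+oo
       [(fun p => (derive1n k (fun s => poisson s f p) y)%:E)]
     <= (C * y `^ (- k%:R + al))%:E)%E) ->
  exists C : R, {ae (@spacetime_measure R n), forall q, q.1 <= t0 ->
    forall y, 0 < y ->
    `|moment_comb (iter k moment_comb_deriv l0) (heat F q) y| <=
      C * y `^ (al - k%:R)}.
Proof.
move=> HF fF [C HC]; exists C.
have aeij : {ae (@spacetime_measure R n), forall q, forall i j : nat,
    (`|(derive1n k (fun s => poisson s f q) (i.+1%:R / j.+1%:R))%:E| <=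
     (C * (i.+1%:R / j.+1%:R) `^ (- k%:R + al))%:E)%E}.
  apply: ae_foralln => i; apply: ae_foralln => j.
  by apply: Lnorm_infty_le; apply: HC; rewrite divr_gt0.
apply: (@filterS _ _ (ae_filter_ringOfSetsType _)) aeij => q qij qt0 y y0.
have hq := profile_heat HF q.
have fFq s : 0 < s -> poisson s f q = moment_comb l0 (heat F q) s.
  move=> s0; rewrite -[RHS](poisson_moment HF q s0); apply: poisson_past => t x tq.
  by apply: fF; rewrite (le_trans tq).
have hij i j : `|moment_comb (iter k moment_comb_deriv l0) (heat F q)
      (i.+1%:R / j.+1%:R)| <= C * (i.+1%:R / j.+1%:R) `^ (al - k%:R).
  have r0 : 0 < i.+1%:R / j.+1%:R :> R by rewrite divr_gt0.
  have := qij i j; rewrite (derive1n_moment_comb k hq fFq r0).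
  by rewrite lee_fin addrC.
pose yj (j : nat) : R := (Num.truncn (y * j.+1%:R)).+1%:R / j.+1%:R.
have yjy : yj j @[j --> \oo] --> y.
  apply/cvgrPdist_le => e e0; near=> j.
  have j0 : 0 < j.+1%:R :> R by [].
  have ej : j.+1%:R^-1 <= e.
    by apply: ltW; near: j; exact: (near_infty_natSinv_lt (PosNum e0)).
  have yj0 : 0 <= y * j.+1%:R by rewrite mulr_ge0// ltW.
  have h1 := truncnS_gt (y * j.+1%:R); have h2 : (Num.truncn (y * j.+1%:R))%:R <= y * j.+1%:R by rewrite truncn_le.
  rewrite distrC ger0_norm; last by rewrite subr_ge0 /yj ler_pdivlMr// ltW.
  rewrite lerBlDr (le_trans _ (lerD ej (lexx y)))// /yj ler_pdivrMr//.
  by rewrite mulrDl mulVf ?gt_eqF// -natr1 addrC lerD2l.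
have cU : {for y, continuous (moment_comb (iter k moment_comb_deriv l0) (heat F q))}.
  apply/differentiable_continuous/derivable1_diffP.
  by have [d _] := is_derive_moment_comb (iter k moment_comb_deriv l0) hq y0; exact: d.
have lim1 : `|moment_comb (iter k moment_comb_deriv l0) (heat F q) (yj j)| @[j --> \oo]
    --> `|moment_comb (iter k moment_comb_deriv l0) (heat F q) y|.
  by apply: cvg_norm; exact: (cvg_comp _ _ yjy cU).
have lim2 : C * (yj j) `^ (al - k%:R) @[j --> \oo] --> C * y `^ (al - k%:R).
  apply: cvgM; first exact: cvg_cst.
  apply: (@cvg_comp _ _ _ yj (fun t : R => t `^ (al - k%:R)) _ _ _ yjy).
  exact: continuous_powRl.
by apply: (ler_cvg_to lim1 lim2); apply: nearW => j; exact: hij.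
Unshelve. all: end_near. Qed.

(** The points of the past where the derivative bounds hold satisfy
    [defect y <= defect x + C * y `^ a] for [x < y], and the defect at [x] is at
    most twice the Poisson integral; [x] tending to [0] leaves a multiple of the
    value of [F]. Such points accumulate at [(t0, x0)], where [F] vanishes, and
    Fatou's lemma passes to the limit. *)
Lemma defect_bound M F f (t0 al a : R) x0 m k : bounded_nonneg M F ->
  continuous F -> F (t0, x0) = 0 ->
  (forall t x, t <= t0 -> f (t, x) = F (t, x)) ->
  (exists C : R, forall y, 0 < y ->
    ('N[@spacetime_measure R n]_+oo
       [(fun p => (derive1n k (fun s => poisson s f p) y)%:E)]
     <= (C * y `^ (- k%:R + al))%:E)%E) ->
  (1 <= m <= 2)%N -> (m <= k)%N -> m.-1%:R < a -> a < m%:R -> a <= al ->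
  exists C : R, forall y, 0 < y -> y <= 2^-1 ->
    defect m (fun y => poisson y F (t0, x0)) y <= C * y `^ a.
Proof.
have arith (D X T u w e : R) : D <= X + T -> X <= 2 * u -> u <= w + e / 2 ->
    D <= 2 * w + T + e by lra.
move=> HF cF Fp0 fF HL m12 mk ma am aal.
have [C0 HC0] := Lambda_derivative_bound HF fF HL.
have F0 q : 0 <= F q by have /andP[] := HF.2 q.
pose U j p y := moment_comb (iter j moment_comb_deriv l0) (heat F p) y.
pose P : set ST := [set q | q.1 <= t0 /\ forall y, 0 < y ->
  `|U k q y| <= C0 * y `^ (al - k%:R)].
have UE p y : 0 < y -> U 0 p y = poisson y F p.
  by move=> y0; rewrite /U (poisson_moment HF).
have dUE q y : 0 < y -> defect m (U 0 q) y = defect m (fun y => poisson y F q) y.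
  move=> y0; have y20 : 0 < 2 * y by rewrite mulr_gt0.
  rewrite /defect; case: (m == 1%N); first exact: UE.
  by congr (2 * _ - _); exact: UE.
have [C C_ge0 HC] : exists2 C : R, 0 <= C & forall q x y, P q -> 0 < x -> x < y ->
    y <= 2^-1 -> defect m (U 0 q) y <= defect m (U 0 q) x + C * y `^ a.
  apply: (@defect_hoelder R ST U setT _ _ m k a P) => //.
  - move=> j q y _ y0; exact: (is_derive_moment_comb _ (profile_heat HF q) y0).
  - move=> j; have [B HB] := moment_comb1_bounded M (iter j moment_comb_deriv l0).
    by exists B => q _; apply: HB; exact: profile_heat.
  exists `|C0| => q y [_ Pq] y0 y1; rewrite (le_trans (Pq y y0))//.
  rewrite ler_pM ?powR_ge0 ?ler_norm//; last first.
    by rewrite ger_powR ?y0// lerD2r.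
  have := le_trans (normr_ge0 _) (Pq y y0).
  by rewrite pmulr_lge0// powR_gt0.
exists C => y y0 yh.
have e_gt0 (i : nat) : 0 < i.+1%:R^-1 :> R by rewrite invr_gt0.
have /choice[p_ Hp] : forall i : nat, exists q, [/\ P q, t0 - i.+1%:R^-1 < q.1,
    q.1 < t0 & rV_box x0 i.+1%:R^-1 q.2].
  move=> i; have [q [Pq q1 q2 qb]] := ae_past_dense (t0, x0) HC0 (e_gt0 i).
  by exists q; split => //; split; [exact: ltW|exact: Pq (ltW q2)].
have pp (d : R) : 0 < d -> \forall i \near \oo,
    `|(p_ i).1 - (t0, x0).1| < d /\ rV_box (t0, x0).2 d (p_ i).2.
  move=> d0; near=> i; have [_ q1 q2 qb] := Hp i.
  have id : i.+1%:R^-1 < d by near: i; exact: (near_infty_natSinv_lt (PosNum d0)).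
  split => [|j]; last exact: lt_trans (qb j) id.
  by rewrite /= ltr_distl (lt_trans _ q1) ?(lt_trans q2)//= ?ltrDl// ltrD2l ltrN2.
have Fp i : defect m (fun y => poisson y F (p_ i)) y <=
    2 * Num.sqrt pi * F (p_ i) + C * y `^ a.
  have [Pq _ _ _] := Hp i.
  apply/ler_addgt0Pr => e e0; have e20 : 0 < e / 2 by rewrite divr_gt0.
  have [z z0 Hz] := poisson_le_near HF (cF (p_ i)) e20.
  pose x := Num.min z y / 2.
  have zy0 : 0 < Num.min z y by rewrite lt_min z0.
  have x0' : 0 < x by rewrite divr_gt0.
  have xzy : x < Num.min z y by rewrite ltr_pdivrMr// ltr_pMr// ltr1n.
  have xz : x < z by rewrite (lt_le_trans xzy)// ge_min lexx.
  have xy : x < y by rewrite (lt_le_trans xzy)// ge_min lexx orbT.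
  have y20 : 0 < 2 * y by rewrite mulr_gt0.
  have x20 : 0 < 2 * x by rewrite mulr_gt0.
  have h1 := HC _ _ _ Pq x0' xy yh.
  rewrite (dUE _ _ y0) (dUE _ _ x0') in h1.
  have h2 := @defect_le_double R m (fun y => poisson y F (p_ i)) x
    (poisson_ge0 HF _ x0') (poisson_ge0 HF _ x20).
  by rewrite -mulrA; exact: arith h1 h2 (Hz x x0' xz).
rewrite -lee_fin (defect_poissonEFin HF)//.
apply: (@fatou_heat _ _ M F (t0, x0) (defect_weight m y) p_
  (fun i => 2 * Num.sqrt pi * F (p_ i) + C * y `^ a)) => //.
- exact: measurable_defect_weight.
- by move=> s s0; rewrite ltW// defect_weight_gt0.
- by move=> i; rewrite -(defect_poissonEFin HF)// lee_fin.
rewrite -[X in _ --> X]add0r; apply: cvgD; last exact: cvg_cst.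
rewrite -(mulr0 (2 * Num.sqrt pi)); apply: cvgM; first exact: cvg_cst.
apply/cvgrPdist_lt => e e0; have [d d0 dF] := continuous_box (cF (t0, x0)) e0.
apply: filterS (pp d d0) => i [q1 q2]; rewrite -Fp0 distrC.
by rewrite [p_ i]surjective_pairing; exact: dF.
Unshelve. all: end_near. Qed.

End regularity.

(** * The maximum principle *)

Section maximum_principle.
Context {R : realType} (n : nat).
Notation leb := (@lebesgue_measure R).
Notation ST := (R * 'rV[R]_n)%type.
Implicit Types (f F : ST -> R) (p : ST) (m k : nat) (y s : R).

Lemma poisson_past_eq0 M F p y : bounded_nonneg M F -> 0 < y ->
  (forall t x, t <= p.1 -> F (t, x) = 0) -> poisson y F p = 0.
Proof.
(* [F - F] stands for the zero function, to conclude by linearity *)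
move=> HF y0 F0; rewrite (@poisson_past _ _ F (fun q => F q - F q)); last first.
  by move=> t x tp; rewrite F0// subrr.
by rewrite (poissonB _ HF HF)// subrr.
Qed.

(** At a zero of [f] the integrand of the fractional power is, up to sign, the
    defect; for two differences this is where the semigroup law enters. *)
Lemma poisson_diff_defect M F f p m y : bounded_nonneg M F -> 0 < y ->
  f p = 0 -> F p = 0 -> (1 <= m <= 2)%N ->
  (forall t x, t <= p.1 -> f (t, x) = F (t, x)) ->
  poisson_diff m y f p = - (-1) ^+ m * defect m (fun y => poisson y F p) y.
Proof.
move=> HF y0 fp Fp m12 fF.
have Pf q : q.1 <= p.1 -> poisson y f q = poisson y F q.
  by move=> qp; apply: poisson_past => t x tq; apply: fF; exact: le_trans qp.
have pp : p.1 <= p.1 by [].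
case: m m12 => [|[|[|//]]]// _.
  transitivity (poisson y F p - 0).
    exact: (f_equal2 (fun a b : R => a - b) (Pf p pp) fp).
  by rewrite /defect/= expr1 opprK mul1r subr0.
have e1 : poisson y (fun q => poisson y f q - f q) p =
    poisson (2 * y) F p - poisson y F p.
  transitivity (poisson y (fun q => poisson y F q - F q) p).
    apply: poisson_past => t x tp.
    exact: (f_equal2 (fun a b : R => a - b) (Pf (t, x) tp) (fF t x tp)).
  rewrite [LHS](poissonB _ (bounded_nonneg_poisson HF y0) HF y0).
  exact: (f_equal (fun c : R => c - _) (poisson_semigroup _ HF y0)).
transitivity ((poisson (2 * y) F p - poisson y F p) - (poisson y F p - 0)).
  exact: (f_equal2 (fun a b : R => a - b) e1
    (f_equal2 (fun a b : R => a - b) (Pf p pp) fp)).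
rewrite /defect/=; move: (poisson (2 * y) F p) (poisson y F p) => A B.
by rewrite sqrrN expr1n; ring.
Qed.

Lemma integrable_frac_const (b : R) m : 0 < b -> b < m%:R -> (1 <= m)%N ->
  leb.-integrable `]0, +oo[
    (EFin \o (fun s => (1 - expR (- s)) ^+ m / s `^ (1 + b))).
Proof.
move=> b0 bm m1.
have e01 s : 0 < s -> 0 <= 1 - expR (- s) <= 1.
  move=> s0; apply/andP; split; last by rewrite gerBl expR_ge0.
  by rewrite subr_ge0 expR_le1 oppr_le0 ltW.
apply: (@integrable_div_powR _ _ m%:R b 1 1) => //.
- apply: measurable_funTS; apply: measurable_funX; apply: measurable_funB => //.
  by apply: measurableT_comp => //.
- by move=> s /e01/andP[e0 _]; exact: exprn_ge0.
- move=> s s0 _; rewrite mul1r powR_mulrn ?(ltW s0)//.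
  have /andP[e0 _] := e01 s s0.
  apply: lerXn2r; rewrite ?nnegrE ?(ltW s0)//.
  by have := expR_ge1Dx (- s); lra.
- by move=> s /e01/andP[e0 e1]; exact: exprn_ile1.
Qed.

End maximum_principle.

Theorem theorem9 (R : realType) (n : nat) (n_ge1 : (1 <= n)%N)
    (alpha beta : R) (beta_gt0 : 0 < beta) (beta_lt1 : beta < 1)
    (alpha_gt : 2 * beta < alpha)
    (f : R * 'rV[R]_n -> R) (f_Lambda : Lambda alpha f) (f_cont : continuous f)
    (t0 : R) (x0 : 'rV[R]_n)
    (f_eq0 : f (t0, x0) = 0)
    (f_ge0 : forall (t : R) (x : 'rV[R]_n), t <= t0 -> 0 <= f (t, x)) :
  frac_power beta f (t0, x0) <= 0 /\
  (frac_power beta f (t0, x0) = 0 <->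
     forall (t : R) (x : 'rV[R]_n), t <= t0 -> f (t, x) = 0).
Proof.
have [M M0 fM] := Lambda_bounded f_Lambda f_cont.
pose F p := Num.max (f p) 0.
have fF t x : t <= t0 -> f (t, x) = F (t, x).
  by move=> tt0; rewrite /F max_l// f_ge0.
have HF : bounded_nonneg M F.
  split=> [|p]; last first.
    by rewrite /F le_max lexx orbT/= ge_max M0 andbT (le_trans (ler_norm _)).
  apply: measurable_maxr => //.
  by have [+ _] := f_Lambda; rewrite inE/= => /andP[]; rewrite inE.
have cF : continuous F by exact: continuous_max0.
have Fp0 : F (t0, x0) = 0 by rewrite -fF.
have b0 : 0 < 2 * beta by rewrite mulr_gt0.
set m := (Num.truncn (2 * beta)).+1.
have bm : 2 * beta < m%:R by exact: truncnS_gt.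
have mb : m.-1%:R <= 2 * beta by rewrite /m/= truncn_le ltW.
have m12 : (1 <= m <= 2)%N.
  rewrite /m ltnS leq0n/= ltnS truncn_le_nat.
  by rewrite gtr_pMr.
have mk : (m <= (Num.truncn alpha).+1)%N by rewrite ltnS le_truncn// ltW.
(* The exponent [a] lies between [2 * beta] and both [alpha] and [m]; so it is
   strictly between [m - 1] and [m]. *)
pose mn := Num.min alpha m%:R.
have bmn : 2 * beta < mn by rewrite lt_min alpha_gt.
pose a := (2 * beta + mn) / 2.
have [ba amn] : 2 * beta < a /\ a < mn by rewrite /a; split; lra.
have am : a < m%:R by rewrite (lt_le_trans amn)// ge_min lexx orbT.
have aal : a <= alpha by rewrite ltW// (lt_le_trans amn)// ge_min lexx.
have [C HC] := defect_bound HF cF Fp0 fF f_Lambda.2 m12 mk (le_lt_trans mb ba) am aal.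
pose psi y := defect m (fun y => poisson y F (t0, x0)) y.
have psi0 y : 0 < y -> 0 <= psi y by move=> y0; exact: (defect_poisson_ge0 HF).
have mpsi : measurable_fun (`]0, +oo[%classic : set (measurableTypeR R)) psi.
  exact: (measurable_defect_poisson HF).
have ipsi : (@lebesgue_measure R).-integrable `]0, +oo[
    (EFin \o (fun s => psi s / s `^ (1 + 2 * beta))).
  apply: (@integrable_div_powR _ _ a _ C (2 * (M * Num.sqrt pi))) => // s s0.
  have s20 : 0 < 2 * s by rewrite mulr_gt0.
  apply: le_trans (@defect_le_double _ m (fun y => poisson y F (t0, x0)) s _ _) _.
  - exact: (poisson_ge0 HF).
  - exact: (poisson_ge0 HF).
  by rewrite ler_pM2l// (poisson_le HF).
have ie := integrable_frac_const b0 bm (isT : (1 <= m)%N).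
pose Ie := \int[lebesgue_measure]_(s in `]0, +oo[)
  ((1 - expR (- s)) ^+ m / s `^ (1 + 2 * beta)) : R.
pose Ipsi := \int[lebesgue_measure]_(s in `]0, +oo[)
  (psi s / s `^ (1 + 2 * beta)) : R.
have sgn0 : (-1) ^+ m != 0 :> R by rewrite signr_eq0.
have cE : frac_const (2 * beta) = (-1) ^+ m * Ie.
  rewrite /frac_const -/m -RintegralZl//; apply: eq_Rintegral => s _.
  by rewrite mulrA -exprMn mulN1r opprB.
have PE : frac_power beta f (t0, x0) = - (Ipsi / Ie).
  rewrite /frac_power cE -/m.
  rewrite (_ : \int[_]_(_ in _) _ = - (-1) ^+ m * Ipsi).
    rewrite invfM (_ : _ * _ = - (((-1) ^+ m)^-1 * (-1) ^+ m) * (Ipsi / Ie)).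
      by rewrite mulVf// mulN1r.
    have aux (c c' I J : R) : c' * J * (- c * I) = - (c' * c) * (I * J) by ring.
    exact: aux.
  rewrite -RintegralZl//; apply: eq_Rintegral => s; rewrite inE/= in_itv/= andbT => s0.
  rewrite mulrA; apply: (f_equal (fun c : R => c / _)).
  exact: (poisson_diff_defect HF s0 f_eq0 Fp0 m12 fF).
have Ipsi0 : 0 <= Ipsi.
  rewrite /Ipsi /Rintegral fine_ge0// integral_ge0// => s.
  by rewrite /= in_itv/= andbT => s0; rewrite lee_fin divr_ge0 ?powR_ge0 ?psi0.
have Rint0 (phi : R -> R) : (@lebesgue_measure R).-integrable `]0, +oo[ (EFin \o phi) ->
    (forall s, 0 < s -> 0 <= phi s) ->
    \int[lebesgue_measure]_(s in `]0, +oo[) phi s = 0 -> exists2 s, 0 < s & phi s = 0.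
  move=> iphi phi0 I0; have /integrableP[/measurable_EFinP mphi _] := iphi.
  have I0' : (\int[lebesgue_measure]_(s in `]0%R, +oo[) (phi s)%:E = 0)%E.
    by rewrite -[LHS]fineK ?integrable_fin_num//; congr EFin.
  have [s /andP[s0 _] phis] := ge0_integral0y_eq0 mphi phi0 I0' (lexx 0) ltr01.
  by exists s.
have Ie0 : 0 < Ie.
  have e_ge0 s : 0 < s -> 0 < (1 - expR (- s)) ^+ m / s `^ (1 + 2 * beta).
    move=> s0; rewrite divr_gt0 ?powR_gt0// exprn_gt0// subr_gt0 expR_lt1.
    by rewrite oppr_lt0.
  rewrite lt0r; apply/andP; split.
    apply/eqP => /(Rint0 _ ie)[s /e_ge0/ltW//|s /e_ge0 es es0].
    by rewrite es0 ltxx in es.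
  rewrite /Ie /Rintegral fine_ge0// integral_ge0// => s.
  by rewrite /= in_itv/= andbT => /e_ge0/ltW; rewrite lee_fin.
rewrite PE; split; first by rewrite oppr_le0 divr_ge0// ltW.
split=> [/eqP|fpast].
  rewrite oppr_eq0 mulf_eq0 invr_eq0 (gt_eqF Ie0) orbF => /eqP.
  move=> /(Rint0 _ ipsi)[s s0|s s0 /eqP].
    by rewrite divr_ge0 ?powR_ge0 ?psi0.
  rewrite mulf_eq0 invr_eq0 (gt_eqF (powR_gt0 _ s0)) orbF => /eqP psis t x tt0.
  rewrite fF//; exact: (defect_poisson_eq0 HF cF s0 psis).
rewrite (_ : Ipsi = 0) ?mul0r ?oppr0//.
rewrite /Ipsi (_ : \int[_]_(_ in _) _ =
  \int[lebesgue_measure]_(s in `]0%R, +oo[) (0 * (psi s / s `^ (1 + 2 * beta)))).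
  by rewrite RintegralZl// mul0r.
apply: eq_Rintegral => s; rewrite inE/= in_itv/= andbT => s0; rewrite mul0r.
have past0 t x : t <= (t0, x0).1 -> F (t, x) = 0.
  by move=> tt0; rewrite -fF// fpast.
have s20 : 0 < 2 * s by rewrite mulr_gt0.
rewrite /psi /defect !(poisson_past_eq0 HF)// mulr0 subrr.
by case: ifP; rewrite mul0r.
Qed.
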